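(* There exists a polynomial-time online algorithm such that for every instance $\mathcal I$ of the generalized model of stochastic horizons, \[ \mathsf{ALG}(\mathcal I)\ge\tfrac12\,\mathsf{LP}^{\mathsf{cond}}(\mathcal I)\ge\tfrac12\,\mathsf{OPT}(\mathcal I), \] i.e., the algorithm is $\tfrac12$-approximate. In particular, for the \textsc{Correl} model with random-order arrivals, $\inf_{\mathcal I\in\textsc{Correl}\cap\textsc{Rand}}\mathsf{ALG}(\mathcal I)/\mathsf{OPT}(\mathcal I)\ge\inf_{\mathcal I\in\textsc{Correl}\cap\textsc{Rand}}\mathsf{ALG}(\mathcal I)/\mathsf{LP}^{\mathsf{cond}}(\mathcal I)\ge\tfrac12$.
   Context: Generalized model of stochastic horizons: $n$ resources with integer capacities $k_i\ge1$ and $m$ query types with rewards $r_{i,j}\ge0$. A random total demand (horizon) $D$, a nonnegative integer with known distribution of finite support, is drawn; $T=\max\{t\ge0:\Pr[D=t]>0\}$. Queries arrive at steps $t=1,\dots,D$; the query at step $t$ has type $j$ with known probability $p_{t,j}$ ($\sum_jp_{t,j}=1$), independently across steps and of $D$. An online algorithm knows these distributions, observes each query's type upon arrival and irrevocably matches it to at most one resource with remaining capacity (collecting $r_{i,j}$) or leaves it unmatched, without knowing $D$ in advance. $\mathsf{ALG}(\mathcal I)$ is its expected total reward; $\mathsf{OPT}(\mathcal I)$ is the supremum over online algorithms. $\mathsf{LP}^{\mathsf{cond}}(\mathcal I)$: maximize $\sum_{i,j}\sum_{t=1}^T\Pr[D\ge t]\,r_{i,j}y^t_{i,j}$ s.t.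 $\sum_j\sum_{t=1}^Ty^t_{i,j}\le k_i$ for all $i$; $\sum_i y^t_{i,j}\le p_{t,j}$ for all $j,t$; $y\ge0$. The model \textsc{Correl}$\cap$\textsc{Rand}: a total demand $D$ is drawn from an arbitrary known distribution, each of the $D$ queries independently draws type $j$ with probability $p_j$ ($\sum_jp_j=1$), and the queries arrive in uniformly random order; this is the special case of the generalized model with $p_{t,j}=p_j$ for all $t$. *)

(* Defs.v *)
(* MathComp / MathComp-Analysis. *)
From HB Require Import structures.
From mathcomp Require Import all_boot all_order all_algebra.
From mathcomp Require Import classical_sets reals constructive_ereal.
From mathcomp Require Import ereal.
Set Implicit Arguments.
Unset Strict Implicit.
Unset Printing Implicit Defensive.
Import Order.TTheory GRing.Theory Num.Theory.
Local Open Scope classical_set_scope.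
Local Open Scope ring_scope.

(** * Stochastic horizons *)

(* Steps are numbered from 0: [t : 'I_T] is the (t+1)-st step, so it takes
   place iff the horizon D satisfies [t < D].  The horizon ranges over
   {0, ..., T}, [demand d] being Pr[D = d]. *)
Record instance (F : Type) (n m T : nat) := Instance {
  cap : 'I_n -> nat;
  reward : 'I_n -> 'I_m -> F;
  demand : 'I_T.+1 -> F;
  ptype : 'I_T -> 'I_m -> F }.

(* The last conjunct makes T the largest element of the support of D. *)
Definition valid (F : numDomainType) n m T (I : instance F n m T) : Prop :=
  [/\ forall i, (1 <= cap I i)%N,
      forall i j, 0 <= reward I i j,
      forall t j, 0 <= ptype I t j,
      forall t, \sum_j ptype I t j = 1 &
      [/\ forall d, 0 <= demand I d,
          \sum_d demand I d = 1 &
          0 < demand I ord_max]].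

Definition map_instance (F G : Type) (f : F -> G) n m T
    (I : instance F n m T) : instance G n m T :=
  Instance (cap I) (fun i j => f (reward I i j)) (fun d => f (demand I d))
           (fun t j => f (ptype I t j)).

(* The i.i.d. (hence exchangeable) case: correlated total demand with
   random-order arrivals. *)
Definition correl_rand (F : Type) n m T (I : instance F n m T) : Prop :=
  exists p : 'I_m -> F, forall t j, ptype I t j = p j.

(** * Online algorithms *)

(* One step of a run: the type of the query and the decision taken, [Some i]
   for a match with resource i and [None] for an unmatched query. *)
Definition event (n m : nat) : Type := ('I_m * option 'I_n)%type.

(* [pi h j a] is the probability of taking decision [a] on a query of type [j]
   when the previous steps were [h], in chronological order.  The step number
   is [size h]; the horizon is not an argument. *)
Definition policy (F : Type) (n m : nat) : Type :=
  seq (event n m) -> 'I_m -> option 'I_n -> F.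

Definition used n m (h : seq (event n m)) (i : 'I_n) : nat :=
  count (fun e : event n m => e.2 == Some i) h.

Definition online (F : numDomainType) n m T (I : instance F n m T)
    (pi : policy F n m) : Prop :=
  forall (h : seq (event n m)) (j : 'I_m),
    [/\ forall a, 0 <= pi h j a,
        \sum_a pi h j a = 1 &
        forall i, (cap I i <= used h i)%N -> pi h j (Some i) = 0].

Definition gain (F : numDomainType) n m T (I : instance F n m T)
    (e : event n m) : F :=
  if e.2 is Some i then reward I i e.1 else 0.

(* Probability of the run [x] given D = d. *)
Definition run_prob (F : numDomainType) n m T (I : instance F n m T)
    (pi : policy F n m) (d : 'I_T.+1)
    (x : d.-tuple ('I_m * option 'I_n)%type) : F :=
  \prod_(t < d) (ptype I (widen_ord (leq_ord d) t) (tnth x t).1 *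
                 pi (take t x) (tnth x t).1 (tnth x t).2).

Definition ALG (F : numDomainType) n m T (I : instance F n m T)
    (pi : policy F n m) : F :=
  \sum_(d < T.+1) demand I d *
    \sum_(x : d.-tuple ('I_m * option 'I_n)%type)
      run_prob I pi x * \sum_(t < d) gain I (tnth x t).

Definition OPT (R : realType) n m T (I : instance R n m T) : R :=
  sup [set ALG I pi | pi in [set pi | online I pi]].

(** * The conditional linear program *)

Definition survival (F : numDomainType) n m T (I : instance F n m T)
    (t : 'I_T) : F :=
  \sum_(d < T.+1 | (t < d)%N) demand I d.

Definition lp_feasible (F : numDomainType) n m T (I : instance F n m T)
    (y : 'I_T -> 'I_n -> 'I_m -> F) : Prop :=
  [/\ forall i, \sum_j \sum_t y t i j <= (cap I i)%:R,
      forall j t, \sum_i y t i j <= ptype I t j &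
      forall t i j, 0 <= y t i j].

Definition lp_objective (F : numDomainType) n m T (I : instance F n m T)
    (y : 'I_T -> 'I_n -> 'I_m -> F) : F :=
  \sum_i \sum_j \sum_t survival I t * reward I i j * y t i j.

Definition LPcond (R : realType) n m T (I : instance R n m T) : R :=
  sup [set lp_objective I y | y in [set y | lp_feasible I y]].

(** * Polynomial time: a structured random-access machine over the naturals,
    with logarithmic (bit-length) cost and access to fair coins *)

Inductive expr : Type :=
| Const of nat
| Read of expr              (* indirect: the argument is the address *)
| Coin of expr              (* the argument is the index of the coin *)
| Add of expr & expr
| Sub of expr & expr        (* truncated *)
| Mul of expr & expr.

Inductive cmd : Type :=
| Skip
| Store of expr & expr      (* address, value *)
| Seq of cmd & cmd
| If of expr & cmd & cmd    (* a nonzero value is true *)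
| While of expr & cmd.

Definition memory := nat -> nat.

Definition bitlen (x : nat) : nat := (trunc_log 2 x).+1.

Fixpoint eval (w : nat -> bool) (s : memory) (e : expr) : nat :=
  match e with
  | Const x => x
  | Read a => s (eval w s a)
  | Coin a => w (eval w s a)
  | Add a b => (eval w s a + eval w s b)%N
  | Sub a b => (eval w s a - eval w s b)%N
  | Mul a b => (eval w s a * eval w s b)%N
  end.

Fixpoint eval_cost (w : nat -> bool) (s : memory) (e : expr) : nat :=
  match e with
  | Const x => bitlen x
  | Read a => (eval_cost w s a + bitlen (eval w s a) +
               bitlen (s (eval w s a)))%N
  | Coin a => (eval_cost w s a + bitlen (eval w s a))%N
  | Add a b | Sub a b | Mul a b =>
      (eval_cost w s a + eval_cost w s b +
       bitlen (eval w s a) + bitlen (eval w s b))%N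
  end.

(* [exec w c s k s']: with coins [w], the command [c] started in memory [s]
   halts in memory [s'] after a computation of cost [k]. *)
Inductive exec (w : nat -> bool) : cmd -> memory -> nat -> memory -> Prop :=
| ExecSkip s : exec w Skip s 1 s
| ExecStore a b s :
    exec w (Store a b) s
      (eval_cost w s a + eval_cost w s b +
       bitlen (eval w s a) + bitlen (eval w s b))%N
      [eta s with eval w s a |-> eval w s b]
| ExecSeq c1 c2 s1 s2 s3 k1 k2 :
    exec w c1 s1 k1 s2 -> exec w c2 s2 k2 s3 ->
    exec w (Seq c1 c2) s1 (k1 + k2)%N s3
| ExecIfTrue e c1 c2 s s' k :
    eval w s e != 0%N -> exec w c1 s k s' ->
    exec w (If e c1 c2) s (eval_cost w s e + k)%N s'
| ExecIfFalse e c1 c2 s s' k :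
    eval w s e = 0%N -> exec w c2 s k s' ->
    exec w (If e c1 c2) s (eval_cost w s e + k)%N s'
| ExecWhileTrue e c s1 s2 s3 k1 k2 :
    eval w s1 e != 0%N -> exec w c s1 k1 s2 -> exec w (While e c) s2 k2 s3 ->
    exec w (While e c) s1 (eval_cost w s1 e + k1 + k2)%N s3
| ExecWhileFalse e c s :
    eval w s e = 0%N -> exec w (While e c) s (eval_cost w s e) s.

(* Nonnegative rationals, as a numerator and a denominator. *)
Definition encode_rat (x : rat) : seq nat := [:: `|numq x|%N; `|denq x|%N].

Definition encode_instance n m T (I : instance rat n m T) : seq nat :=
  [:: n; m; T] ++
  [seq cap I i | i <- enum 'I_n] ++
  flatten [seq encode_rat (reward I i j) | i <- enum 'I_n, j <- enum 'I_m] ++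
  flatten [seq encode_rat (demand I d) | d <- enum 'I_T.+1] ++
  flatten [seq encode_rat (ptype I t j) | t <- enum 'I_T, j <- enum 'I_m].

Definition encode_decision n (a : option 'I_n) : nat :=
  if a is Some i then i.+1 else 0%N.

Definition encode_history n m (h : seq (event n m)) : seq nat :=
  size h :: flatten [seq [:: nat_of_ord e.1; encode_decision e.2] | e <- h].

Definition bit_size n m T (I : instance rat n m T) : nat :=
  (\sum_(x <- encode_instance I) bitlen x)%N.

(* Input cells start at address 0, all other cells being zero; the decision is
   read off cell 0. *)
Definition initial_memory n m T (I : instance rat n m T)
    (h : seq (event n m)) (j : 'I_m) : memory :=
  nth 0%N (encode_instance I ++ encode_history h ++ [:: nat_of_ord j]).

(* With at most B units of time and B fresh fair coins for each decision, the
   program [c] makes the decisions with the probabilities given by [pi].  There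
   are T <= bit_size I decisions in all, each computed anew from the instance
   and the history. *)
Definition implements (R : realType) (c : cmd) (B : nat) n m T
    (I : instance rat n m T) (pi : policy R n m) : Prop :=
  forall (h : seq (event n m)) (j : 'I_m), (size h < T)%N ->
  exists out : B.-tuple bool -> option 'I_n,
    (forall w : B.-tuple bool, exists (k : nat) (s : memory),
       [/\ exec (nth false w) c (initial_memory I h j) k s,
           (k <= B)%N & s 0%N = encode_decision (out w)]) /\
    (forall a, pi h j a = #|[pred w | out w == a]|%:R / 2 ^+ B).

(* Running time is meaningful on finitely encoded, i.e. rational, instances;
   one program handles all of them, in time polynomial in their bit size. *)
Definition polynomial_time (R : realType)
    (A : forall n m T, instance R n m T -> policy R n m) : Prop :=
  exists (c : cmd) (e : nat),
    forall n m T (I : instance rat n m T), valid I ->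
      implements c (e * bit_size I ^ e)%N I
        (A n m T (map_instance (@ratr R) I)).

(** * Performance ratios over the random-order correlated instances *)

(* Instances with zero denominator (ratio 0/0) are left out. *)
Definition ratios_OPT (R : realType)
    (A : forall n m T, instance R n m T -> policy R n m) : set (\bar R) :=
  [set x | exists n m T (I : instance R n m T),
    [/\ valid I, correl_rand I, 0 < OPT I &
        x = (ALG I (A n m T I) / OPT I)%:E]].

Definition ratios_LPcond (R : realType)
    (A : forall n m T, instance R n m T -> policy R n m) : set (\bar R) :=
  [set x | exists n m T (I : instance R n m T),
    [/\ valid I, correl_rand I, 0 < LPcond I &
        x = (ALG I (A n m T I) / LPcond I)%:E]].

(* Main.v *)
Require Import Defs.
From mathcomp Require Import all_boot all_order all_algebra.
From mathcomp Require Import classical_sets reals constructive_ereal ereal.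
From mathcomp Require Import boolp zify ring.
(* Required again so that its names take precedence over MathComp's. *)
Require Import Defs.
Set Implicit Arguments.
Unset Strict Implicit.
Unset Printing Implicit Defensive.
Import Order.TTheory GRing.Theory Num.Theory.

(* No linear program is solved.  Write S_t for the probability that step t takes
   place.  Prices mu_i, initially 0, are raised backwards in time: for
   t = T, ..., 1 and every type j, let i be a resource maximizing the margin
   b_{t,j} = (S_t r_{i,j} - mu_i)^+, and add (p_{t,j} / k_i) b_{t,j} to mu_i.
   The policy offers a query of type j at step t to that maximizing resource,
   and matches it if the margin is positive and capacity remains.
   - The final prices mu_i together with the margins b_{t,j} are feasible for
     the dual of LPcond (prices only increase), and sum_i k_i mu_i =
     sum_{t,j} p_{t,j} b_{t,j} by construction, so that
     LPcond <= 2 sum_i k_i mu_i.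
   - By backward induction, the expected reward collected by the policy from
     step t on, from remaining capacities x <= k, is at least
     sum_i x_i mu_i, for mu the prices once steps T, ..., t have been treated:
     x_i / k_i is at most 1, and 0 when resource i is exhausted.
     Hence ALG >= sum_i k_i mu_i.
   - OPT <= LPcond since the matching probabilities of a policy over T steps
     form a feasible solution.
   Each update of mu_i multiplies its denominator by polynomially many bits, so
   exact fractions, never reduced, stay of polynomial length. *)

(** * Bit lengths and the cost of evaluating expressions *)

Lemma bitlen_le (L x : nat) : (0 < L)%N -> (x < 2 ^ L)%N -> (bitlen x <= L)%N.
Proof.
case: L => // L _; rewrite /bitlen ltnS.
case: (posnP x) => [->|x0] H; first by rewrite trunc_log0.
rewrite -ltnS -(@ltn_exp2l 2) //; apply: leq_ltn_trans H.
exact: trunc_logP.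
Qed.

Lemma ltn_bitlen x : (x < 2 ^ bitlen x)%N. Proof. exact: trunc_log_ltn. Qed.

Lemma bitlen_add x y : (bitlen (x + y) <= bitlen x + bitlen y)%N.
Proof.
apply: bitlen_le => //; rewrite expnD.
have := ltn_bitlen x; have := ltn_bitlen y.
have: (2 <= 2 ^ bitlen x)%N by rewrite -{1}(expn1 2) leq_exp2l.
have: (2 <= 2 ^ bitlen y)%N by rewrite -{1}(expn1 2) leq_exp2l.
nia.
Qed.

Lemma bitlen_mul x y : (bitlen (x * y) <= bitlen x + bitlen y)%N.
Proof.
apply: bitlen_le => //; rewrite expnD.
by apply: ltn_mul; exact: ltn_bitlen.
Qed.

Lemma bitlen_sub x y : (bitlen (x - y) <= bitlen x)%N.
Proof. by apply: bitlen_le => //; apply: leq_ltn_trans (ltn_bitlen x); lia. Qed.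

(** Lengths are counted in units of L, a common bound on the length of all memory cells. Sums and
    products have at most the added lengths of their arguments, so the length of a value is linear
    in L, with a coefficient that depends on the expression alone. *)
Fixpoint value_coef (e : expr) : nat :=
  match e with
  | Const x => bitlen x
  | Read _ | Coin _ => 1
  | Add a b | Mul a b => value_coef a + value_coef b
  | Sub a _ => value_coef a
  end.

Fixpoint cost_coef (e : expr) : nat :=
  match e with
  | Const x => bitlen x
  | Read a => cost_coef a + value_coef a + 1
  | Coin a => cost_coef a + value_coef a
  | Add a b | Sub a b | Mul a b =>
      cost_coef a + cost_coef b + value_coef a + value_coef b
  end.

Lemma eval_cost_le (w : nat -> bool) (s : memory) (L : nat) (e : expr) :
  (0 < L)%N -> (forall a, s a < 2 ^ L)%N ->
  (bitlen (eval w s e) <= value_coef e * L)%N /\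
  (eval_cost w s e <= cost_coef e * L)%N.
Proof.
move=> L0 sL; have sb a : (bitlen (s a) <= L)%N by exact: bitlen_le.
elim: e => [x|a [IH1 IH2]|a [IH1 IH2]|a [A1 A2] b [B1 B2]
  |a [A1 A2] b [B1 B2]|a [A1 A2] b [B1 B2]] /=.
- by split; exact: leq_pmulr.
- by have := sb (eval w s a); split; nia.
- split; last by nia.
  by rewrite mul1n; apply: leq_trans L0; case: (w _).
- by have := bitlen_add (eval w s a) (eval w s b); split; nia.
- by have := bitlen_sub (eval w s a) (eval w s b); split; nia.
- by have := bitlen_mul (eval w s a) (eval w s b); split; nia.
Qed.

(** * Structured programs with a read-only input *)

(* Registers and an unbounded array live in the memory beyond the input. *)
Inductive wexpr : Type :=
| WC of nat
| WR of nat
| WA of wexpr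
| WI of wexpr
| WAdd of wexpr & wexpr
| WSub of wexpr & wexpr
| WMul of wexpr & wexpr.

(** The only loop is a counted one, its counter running from 0 up to the bound; termination and cost
    then follow from a bound on the number of iterations. *)
Inductive prog : Type :=
| PSkip
| PSet of nat & wexpr
| PArr of wexpr & wexpr
| PSeq of prog & prog
| PIf of wexpr & prog & prog
| PFor of nat & wexpr & prog.

Definition nreg : nat := 16.

Definition state : Type := (memory * memory)%type.

Definition set_reg (s : state) (r v : nat) : state :=
  ([eta s.1 with r |-> v] : memory, s.2).

Definition set_arr (s : state) (a v : nat) : state :=
  (s.1, [eta s.2 with a |-> v] : memory).

Fixpoint keeps (x : nat) (p : prog) : bool :=
  match p with
  | PSkip | PArr _ _ => true
  | PSet r _ => r != x
  | PSeq p q | PIf _ p q => keeps x p && keeps x q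
  | PFor y _ p => (y != x) && keeps x p
  end.

Fixpoint wf (p : prog) : bool :=
  match p with
  | PSkip | PArr _ _ => true
  | PSet r _ => (r < nreg)%N
  | PSeq p q | PIf _ p q => wf p && wf q
  | PFor x _ p => [&& (x < nreg)%N, keeps x p & wf p]
  end.

Section Compilation.
Variables (work : expr) (inp : memory) (base M L : nat).

(** The first free address depends on the length of the input, so it cannot be a literal: every
    access to a register or to the array recomputes it through [work]. *)
Fixpoint compile_expr (e : wexpr) : expr :=
  match e with
  | WC x => Const x
  | WR r => Read (Add work (Const r))
  | WA a => Read (Add work (Add (Const nreg) (compile_expr a)))
  | WI a => Read (compile_expr a)
  | WAdd a b => Add (compile_expr a) (compile_expr b)
  | WSub a b => Sub (compile_expr a) (compile_expr b)
  | WMul a b => Mul (compile_expr a) (compile_expr b)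
  end.

Definition store_reg (r : nat) (e : expr) : cmd :=
  Store (Add work (Const r)) e.

(** The guard of a loop is the truncated difference of bound and counter, nonzero exactly while the
    counter is below the bound. *)
Fixpoint compile (p : prog) : cmd :=
  match p with
  | PSkip => Skip
  | PSet r e => store_reg r (compile_expr e)
  | PArr a e =>
      Store (Add work (Add (Const nreg) (compile_expr a))) (compile_expr e)
  | PSeq p q => Seq (compile p) (compile q)
  | PIf e p q => If (compile_expr e) (compile p) (compile q)
  | PFor x e p =>
      Seq (store_reg x (Const 0))
        (While (compile_expr (WSub e (WR x)))
           (Seq (compile p) (store_reg x (compile_expr (WAdd (WR x) (WC 1))))))
  end.

Definition store_coef (a b : expr) : nat :=
  cost_coef a + cost_coef b + value_coef a + value_coef b.

(* Cost in units of [L], when every loop is executed at most [M] times. *)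
Fixpoint prog_cost (p : prog) : nat :=
  match p with
  | PSkip => 1
  | PSet r e => store_coef (Add work (Const r)) (compile_expr e)
  | PArr a e =>
      store_coef (Add work (Add (Const nreg) (compile_expr a))) (compile_expr e)
  | PSeq p q => prog_cost p + prog_cost q
  | PIf e p q => cost_coef (compile_expr e) + prog_cost p + prog_cost q
  | PFor x e p =>
      store_coef (Add work (Const x)) (Const 0) +
      M * (cost_coef (compile_expr (WSub e (WR x))) + prog_cost p +
           store_coef (Add work (Const x))
             (compile_expr (WAdd (WR x) (WC 1)))) +
      cost_coef (compile_expr (WSub e (WR x)))
  end.

Definition mem_of (s : state) : memory := fun a =>
  if (a < base)%N then inp a else
  if (a - base < nreg)%N then s.1 (a - base)%N else s.2 (a - base - nreg)%N.

Fixpoint weval (s : state) (e : wexpr) : nat :=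
  match e with
  | WC x => x
  | WR r => s.1 r
  | WA a => s.2 (weval s a)
  | WI a => mem_of s (weval s a)
  | WAdd a b => weval s a + weval s b
  | WSub a b => weval s a - weval s b
  | WMul a b => weval s a * weval s b
  end.

Fixpoint wf_expr (e : wexpr) : bool :=
  match e with
  | WC _ => true
  | WR r => (r < nreg)%N
  | WA a | WI a => wf_expr a
  | WAdd a b | WSub a b | WMul a b => wf_expr a && wf_expr b
  end.

Fixpoint wf_exprs (p : prog) : bool :=
  match p with
  | PSkip => true
  | PSet _ e => wf_expr e
  | PArr a e => wf_expr a && wf_expr e
  | PSeq p q => wf_exprs p && wf_exprs q
  | PIf e p q => [&& wf_expr e, wf_exprs p & wf_exprs q]
  | PFor _ e p => wf_expr e && wf_exprs p
  end.

(** A weakest precondition that also asks every stored value to fit in L bits, so that the cost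
    bounds apply along the whole run. A loop bound must have the same value N in all states, hence
    cannot be altered by the body; J is the invariant, stated before the counter is set. *)
Fixpoint wpre (p : prog) (Q : state -> Prop) (s : state) : Prop :=
  match p with
  | PSkip => Q s
  | PSet r e => (weval s e < 2 ^ L)%N /\ Q (set_reg s r (weval s e))
  | PArr a e => (weval s e < 2 ^ L)%N /\ Q (set_arr s (weval s a) (weval s e))
  | PSeq p q => wpre p (wpre q Q) s
  | PIf e p q => if weval s e != 0%N then wpre p Q s else wpre q Q s
  | PFor x e p => exists N (J : nat -> state -> Prop),
      [/\ forall s', weval s' e = N, (N <= M)%N, J 0 s,
          forall i s', (i < N)%N -> J i s' -> wpre p (J i.+1) (set_reg s' x i) &
          forall s', J N s' -> Q (set_reg s' x N)]
  end.

Definition bounded (s : state) : Prop :=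
  (forall r, s.1 r < 2 ^ L)%N /\ (forall a, s.2 a < 2 ^ L)%N.

(** Serves to know that a loop counter still has its value after the body, when it is about to be
    incremented. *)
Lemma wp_frame (x v : nat) (p : prog) (Q Q' : state -> Prop) (s : state) :
  keeps x p -> s.1 x = v -> wpre p Q s ->
  (forall s', s'.1 x = v -> Q s' -> Q' s') -> wpre p Q' s.
Proof.
elim: p Q Q' s => [|r e|a e|p IHp q IHq|e p IHp q IHq|y e p IHp] Q Q' s /=.
- by move=> _ sx qs; exact.
- move=> rx sx [le qs] H; split=> //; apply: H => //=.
  by rewrite eq_sym (negbTE rx).
- by move=> _ sx [le qs] H; split=> //; exact: H.
- move=> /andP[kp kq] sx H1 H2; apply: IHp kp sx H1 _ => s' sx' H3.
  exact: IHq kq sx' H3 H2.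
- move=> /andP[kp kq] sx; case: ifP => _ H1 H2.
    exact: IHp kp sx H1 H2.
  exact: IHq kq sx H1 H2.
- move=> /andP[yx kp] sx [N [J [eN NM J0 JS JQ]]] H.
  exists N, (fun i s' => J i s' /\ s'.1 x = v); split=> //.
    move=> i s' iN [Ji s'x]; apply: IHp kp _ (JS _ _ iN Ji) _ => //=.
    by rewrite eq_sym (negbTE yx).
  move=> s' [Js' s'x]; apply: H (JQ _ Js') => /=.
  by rewrite eq_sym (negbTE yx).
Qed.

Lemma mem_of_reg s r : (r < nreg)%N -> mem_of s (base + r) = s.1 r.
Proof. by move=> rn; rewrite /mem_of ltnNge leq_addr /= addKn rn. Qed.

Lemma mem_of_arr s a : mem_of s (base + (nreg + a)) = s.2 a.
Proof.
by rewrite /mem_of ltnNge leq_addr /= addKn addKn ltnNge leq_addr.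
Qed.

Lemma mem_of_set_reg s r v : (r < nreg)%N ->
  ([eta mem_of s with (base + r)%N |-> v] : memory) = mem_of (set_reg s r v).
Proof.
move=> rn; apply/funext => a /=; rewrite /mem_of /set_reg /=.
case: eqP => [->|ne]; first by rewrite ltnNge leq_addr /= addKn rn eqxx.
case: ifP => // ab; case: ifP => // ab2; case: eqP => // e; case: ne; lia.
Qed.

Lemma mem_of_set_arr s a v :
  ([eta mem_of s with (base + (nreg + a))%N |-> v] : memory) = mem_of (set_arr s a v).
Proof.
apply/funext => b /=; rewrite /mem_of /set_arr /=.
case: eqP => [->|ne].
  by rewrite ltnNge leq_addr /= addKn addKn ltnNge leq_addr /= eqxx.
case: ifP => // ab; case: ifP => // ab2; case: eqP => // e; case: ne.
by rewrite -e; lia.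
Qed.

Variable w : nat -> bool.
Hypothesis workE : forall s, eval w (mem_of s) work = base.
Hypothesis inpL : forall a, (inp a < 2 ^ L)%N.
Hypothesis L_gt0 : (0 < L)%N.

Lemma mem_of_bounded s : bounded s -> forall a, (mem_of s a < 2 ^ L)%N.
Proof. by move=> [b1 b2] a; rewrite /mem_of; do 2?case: ifP. Qed.

Lemma eval_compile s e : wf_expr e -> eval w (mem_of s) (compile_expr e) = weval s e.
Proof.
elim: e => //= [r rn|a IH wa|a IH wa|a IHa b IHb|a IHa b IHb|a IHa b IHb].
- by rewrite workE mem_of_reg.
- by rewrite workE IH // mem_of_arr.
- by rewrite IH.
- by case/andP => wa wb; rewrite IHa // IHb.
- by case/andP => wa wb; rewrite IHa // IHb.
- by case/andP => wa wb; rewrite IHa // IHb.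
Qed.

Lemma store_cost_le s a b : bounded s ->
  (eval_cost w (mem_of s) a + eval_cost w (mem_of s) b +
   bitlen (eval w (mem_of s) a) + bitlen (eval w (mem_of s) b) <=
   store_coef a b * L)%N.
Proof.
move=> bs.
have [] := eval_cost_le w a L_gt0 (mem_of_bounded bs).
have [] := eval_cost_le w b L_gt0 (mem_of_bounded bs).
by rewrite /store_coef; lia.
Qed.

Lemma exec_store_reg s r e : (r < nreg)%N -> bounded s ->
  (eval w (mem_of s) e < 2 ^ L)%N ->
  exists k, [/\ exec w (store_reg r e) (mem_of s) k
                  (mem_of (set_reg s r (eval w (mem_of s) e))),
    (k <= store_coef (Add work (Const r)) e * L)%N &
    bounded (set_reg s r (eval w (mem_of s) e))].
Proof.
move=> rn bs eL; eexists; split.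
- rewrite -mem_of_set_reg //.
  have -> : (base + r)%N = eval w (mem_of s) (Add work (Const r)).
    by rewrite /= workE.
  exact: ExecStore.
- exact: store_cost_le.
- by case: bs => b1 b2; split=> //= x; case: ifP.
Qed.

Hypothesis ML : (M < 2 ^ L)%N.

(** Memory stays bounded by [2 ^ L], so each elementary command costs a constant number of units L,
    and each loop body runs at most M times. *)
Lemma wp_sound (p : prog) (Q : state -> Prop) (s : state) :
  wf p -> wf_exprs p -> bounded s -> wpre p Q s ->
  exists k s', [/\ exec w (compile p) (mem_of s) k (mem_of s'),
    (k <= prog_cost p * L)%N, bounded s' & Q s'].
Proof.
elim: p Q s => [|r e|a e|p IHp q IHq|e p IHp q IHq|x e p IHp] Q s /=.
- move=> _ _ bs Qs; exists 1%N, s; split=> //; first exact: ExecSkip.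
  by rewrite mul1n.
- move=> rn we bs [eL Qs]; rewrite -(eval_compile s we) in eL Qs.
  have [k [ex kL bs']] := exec_store_reg rn bs eL.
  by exists k; eexists; split; [exact: ex| | |].
- move=> _ /andP[wa we] bs [eL Qs].
  eexists; exists (set_arr s (weval s a) (weval s e)); split; last exact: Qs.
  + rewrite -mem_of_set_arr -(eval_compile s wa) -(eval_compile s we).
    set b := Add work _.
    have -> : (base + (nreg + eval w (mem_of s) (compile_expr a)))%N =
      eval w (mem_of s) b by rewrite /b /= workE.
    exact: ExecStore.
  + exact: store_cost_le.
  + by case: bs => b1 b2; split=> //= y; case: ifP.
- move=> /andP[wp1 wq] /andP[ep eq] bs H.
  have [k1 [s1 [e1 l1 b1 H1]]] := IHp _ _ wp1 ep bs H.
  have [k2 [s2 [e2 l2 b2 H2]]] := IHq _ _ wq eq b1 H1.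
  exists (k1 + k2)%N, s2; split=> //; first exact: ExecSeq e1 e2.
  by rewrite mulnDl leq_add.
- move=> /andP[wp1 wq] /and3P[we ep eq] bs.
  have [_ ce] := eval_cost_le w (compile_expr e) L_gt0 (mem_of_bounded bs).
  case: ifP => [e0 | /negbFE/eqP e0] H.
    have [k1 [s1 [e1 l1 b1 H1]]] := IHp _ _ wp1 ep bs H.
    exists (eval_cost w (mem_of s) (compile_expr e) + k1)%N, s1; split=> //.
      by apply: ExecIfTrue e1; rewrite eval_compile.
    by lia.
  have [k1 [s1 [e1 l1 b1 H1]]] := IHq _ _ wq eq bs H.
  exists (eval_cost w (mem_of s) (compile_expr e) + k1)%N, s1; split=> //.
    by apply: ExecIfFalse e1; rewrite eval_compile.
  by lia.
- move=> /and3P[xn kx wfp] /andP[we wep] bs [N [J [eN NM J0 JS JQ]]].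
  set guard := Sub (compile_expr e) _; set incr := Add (Read _) (Const 1).
  set unit := (cost_coef guard + _ + _)%N.
  have guardE s' : eval w (mem_of s') guard = (N - s'.1 x)%N.
    have := @eval_compile s' (WSub e (WR x)); rewrite /= we xn => /(_ isT).
    by rewrite eN.
  (* Induction on the number d of iterations still to be done, the counter already holding i. *)
  have loop : forall d i s', (d + i = N)%N -> J i s' ->
      bounded (set_reg s' x i) ->
      exists k s'', [/\ exec w (While guard
          (Seq (compile p) (store_reg x incr))) (mem_of (set_reg s' x i)) k
          (mem_of s''),
        (k <= (d * unit + cost_coef guard) * L)%N, bounded s'' & Q s''].
    elim=> [|d IHd] i s' diN Ji bi.
      have -> : i = N by lia.
      rewrite (_ : i = N) in bi Ji; last by lia.
      have [_ ce] := eval_cost_le w guard L_gt0 (mem_of_bounded bi).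
      exists (eval_cost w (mem_of (set_reg s' x N)) guard), (set_reg s' x N).
      split=> //; last exact: JQ.
      by apply: ExecWhileFalse; rewrite guardE /= eqxx subnn.
    have iN : (i < N)%N by lia.
    have H : wpre p (fun s1 => J i.+1 s1 /\ s1.1 x = i) (set_reg s' x i).
      by apply: wp_frame kx _ (JS _ _ iN Ji) _ => //=; rewrite eqxx.
    have [k1 [s1 [e1 l1 b1 [J1 x1]]]] := IHp _ _ wfp wep bi H.
    have incrE : eval w (mem_of s1) incr = i.+1.
      have xw : wf_expr (WAdd (WR x) (WC 1)) by rewrite /= xn.
      by rewrite (eval_compile s1 xw) /= x1 addn1.
    (* The incremented counter is at most N, hence at most M, and so fits in L bits. *)
    have i1L : (eval w (mem_of s1) incr < 2 ^ L)%N.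
      by rewrite incrE; apply: leq_ltn_trans ML; lia.
    have [k2 [e2 l2 b2]] := exec_store_reg xn b1 i1L.
    rewrite incrE in e2 b2.
    have [|k3 [s3 [e3 l3 b3 Q3]]] := IHd i.+1 s1 _ J1 b2; first by lia.
    have [_ ce] := eval_cost_le w guard L_gt0 (mem_of_bounded bi).
    exists (eval_cost w (mem_of (set_reg s' x i)) guard + (k1 + k2) + k3)%N, s3.
    split=> //.
      apply: ExecWhileTrue e3; first by rewrite guardE /= eqxx; lia.
      exact: ExecSeq e1 e2.
    by rewrite /unit; lia.
  have z0 : (eval w (mem_of s) (Const 0) < 2 ^ L)%N by rewrite /= expn_gt0.
  have [k0 [e0 l0 b0]] := exec_store_reg xn bs z0.
  have [k1 [s1 [e1 l1 b1 Q1]]] := loop N 0%N s (addn0 N) J0 b0.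
  exists (k0 + k1)%N, s1; split=> //; first exact: ExecSeq e0 e1.
  apply: leq_trans (leq_add l0 l1) _; rewrite -mulnDl leq_mul2r addnA.
  by rewrite leq_add2r leq_add2l leq_mul2r NM !orbT.
Qed.

End Compilation.

(** An upper bound on the degree of the cost as a polynomial in M. Consecutive programs add their
    depths instead of taking the maximum: [M ^ (a + b)] dominates both [M ^ a] and [M ^ b]. *)
Fixpoint depth (p : prog) : nat :=
  match p with
  | PSeq p q | PIf _ p q => depth p + depth q
  | PFor _ _ p => (depth p).+1
  | _ => 0
  end.

Lemma prog_cost_poly work p M : (0 < M)%N ->
  (prog_cost work M p <= prog_cost work 1 p * M ^ depth p)%N.
Proof.
move=> M0; have M1 k : (0 < M ^ k)%N by rewrite expn_gt0 M0.
elim: p => [|r e|a e|p IHp q IHq|e p IHp q IHq|x e p IHp];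
  rewrite [depth _]/= ?expn0 ?muln1 //.
- rewrite /= expnD mulnDl; apply: leq_add.
    by apply: leq_trans IHp _; rewrite mulnA leq_pmulr.
  by apply: leq_trans IHq _; rewrite mulnCA leq_pmull.
- rewrite /= expnD 2!mulnDl; apply: leq_add; first apply: leq_add.
  + by rewrite leq_pmulr // muln_gt0 !M1.
  + by apply: leq_trans IHp _; rewrite mulnA leq_pmulr.
  + by apply: leq_trans IHq _; rewrite mulnCA leq_pmull.
- rewrite /= mul1n 2!mulnDl; apply: leq_add; first apply: leq_add.
  + by rewrite leq_pmulr.
  + rewrite expnS mulnCA leq_mul2l !mulnDl; apply/orP; right.
    by rewrite !leq_add // leq_pmulr.
  + by rewrite leq_pmulr.
Qed.

Local Open Scope ring_scope.

(** * Prices *)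

Section Prices.
Variables (F : realFieldType) (n m T : nat) (kp : nat -> nat).
Variables (rw : nat -> nat -> F) (dm : nat -> F) (pt : nat -> nat -> F).

(* The largest positive margin, with the resource attaining it shifted by 1;
   0 codes for no resource. *)
Definition scan_margins (S : F) (j : nat) (mu : nat -> F) (k : nat) : F * nat :=
  iteri k (fun i acc => if acc.1 < S * rw i j - mu i
                        then (S * rw i j - mu i, i.+1) else acc) (0, 0%N).

Definition raise_price (p S : F) (j : nat) (mu : nat -> F) : nat -> F :=
  fun i => if i.+1 == (scan_margins S j mu n).2
           then mu i + p / (kp i)%:R * (scan_margins S j mu n).1 else mu i.

(** The types of one step are treated one after the other, each seeing the prices already raised by
    the previous types of that step. *)
Definition sweep (t : nat) (S : F) (mu : nat -> F) (k : nat) : nat -> F :=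
  iteri k (fun j nu => raise_price (pt t j) S j nu) mu.

(* The survival probability and the prices after the last [q] steps have been
   treated, latest step first. *)
Fixpoint prices (q : nat) : F * (nat -> F) :=
  if q is q'.+1 then
    let S := (prices q').1 + dm (T - q')%N in
    (S, sweep (T - q) S (prices q').2 m)
  else (0, fun=> 0).

Definition price_before (t j : nat) : nat -> F :=
  sweep t (prices (T - t)).1 (prices (T - t.+1)).2 j.

Definition best_choice (t j : nat) : nat :=
  (scan_margins (prices (T - t)).1 j (price_before t j) n).2.

Definition margin (t j : nat) : F :=
  (scan_margins (prices (T - t)).1 j (price_before t j) n).1.

Lemma scan_ge0 S j mu k : 0 <= (scan_margins S j mu k).1.
Proof.
elim: k => //= k IH; case: ifP => //= H; exact: le_trans IH (ltW H).
Qed.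

Lemma scan_ub S j mu k i : (i < k)%N -> S * rw i j - mu i <= (scan_margins S j mu k).1.
Proof.
elim: k => // k IH; rewrite ltnS leq_eqVlt /= => /orP[/eqP->|ik].
  by case: ifP => //= /negbT; rewrite -leNgt.
by case: ifP => /= H; [apply: le_trans (IH ik) (ltW H) | exact: IH].
Qed.

Lemma scan_none S j mu k :
  (scan_margins S j mu k).2 = 0%N -> (scan_margins S j mu k).1 = 0.
Proof. by elim: k => //= k IH; case: ifP. Qed.

Lemma scan_some S j mu k i : (scan_margins S j mu k).2 = i.+1 ->
  [/\ (i < k)%N, (scan_margins S j mu k).1 = S * rw i j - mu i &
      0 < (scan_margins S j mu k).1].
Proof.
elim: k => //= k IH; case: ifP => /= [H [<-]|_ /IH[ik ? ?]].
  by split=> //; exact: le_lt_trans (scan_ge0 _ _ _ _) H.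
by split=> //; exact: ltnW.
Qed.

(** Writing the increase as a sum over all types, with an indicator, allows the sums over types and
    resources to be exchanged in the analysis of the policy. *)
Lemma sweep_delta t S mu k i :
  sweep t S mu k i = mu i + \sum_(j < k)
    (i.+1 == (scan_margins S j (sweep t S mu j) n).2)%:R *
    (pt t j / (kp i)%:R * (scan_margins S j (sweep t S mu j) n).1).
Proof.
elim: k => [|k IH]; first by rewrite big_ord0 addr0.
rewrite big_ord_recr addrA -IH /= {1}/raise_price.
by case: ifP => _; rewrite ?mul1r // mul0r addr0.
Qed.

Hypothesis kp0 : forall i, (i < n)%N -> (0 < kp i)%N.
Hypothesis pt0 : forall t j, 0 <= pt t j.

Lemma raise_price_ge p S j mu i : 0 <= p -> mu i <= raise_price p S j mu i.
Proof.
move=> p0; rewrite /raise_price; case: ifP => // _.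
by rewrite lerDl mulr_ge0 ?scan_ge0 // divr_ge0.
Qed.

(** Only the best resource changes price, and its capacity cancels the division by [kp i] in the
    raise. *)
Lemma raise_price_sum p S j mu :
  \sum_(i < n) (kp i)%:R * raise_price p S j mu i =
  \sum_(i < n) (kp i)%:R * mu i + p * (scan_margins S j mu n).1.
Proof.
rewrite /raise_price; case E: (scan_margins S j mu n).2 => [|c].
  by rewrite (scan_none E) mulr0 addr0.
have [cn _ _] := scan_some E.
rewrite (bigD1 (Ordinal cn)) //= [in RHS](bigD1 (Ordinal cn)) //= eqxx.
rewrite mulrDr -addrA [in RHS]addrAC -!addrA; congr (_ + _).
have k0 : (kp c)%:R != 0 :> F by rewrite pnatr_eq0 -lt0n kp0.
congr (_ + _); first by field.
apply: eq_bigr => i /negbTE ic; rewrite eqSS.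
by case: eqP => // ic'; case/eqP: ic; apply/val_inj.
Qed.

Lemma sweep_ge t S mu k i : mu i <= sweep t S mu k i.
Proof.
elim: k => //= k IH; exact: le_trans IH (raise_price_ge _ _ _ _ _).
Qed.

Lemma sweep_homo t S mu i :
  {homo (fun k => sweep t S mu k i) : k l / (k <= l)%N >-> k <= l}.
Proof.
by apply: homo_leq => [//|y x z|k]; [exact: le_trans | exact: raise_price_ge].
Qed.

Lemma sweep_sum t S mu k :
  \sum_(i < n) (kp i)%:R * sweep t S mu k i =
  \sum_(i < n) (kp i)%:R * mu i +
  \sum_(j < k) pt t j * (scan_margins S j (sweep t S mu j) n).1.
Proof.
elim: k => [|k IH]; first by rewrite big_ord0 addr0.
by rewrite [LHS]raise_price_sum IH big_ord_recr addrA.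
Qed.

Lemma prices_homo i :
  {homo (fun q => (prices q).2 i) : q r / (q <= r)%N >-> q <= r}.
Proof.
by apply: homo_leq => [//|y x z|k]; [exact: le_trans | exact: sweep_ge].
Qed.

Lemma price_before_le t j i : (t < T)%N -> (j <= m)%N ->
  price_before t j i <= (prices (T - t)).2 i.
Proof.
move=> tT jm; rewrite /price_before.
have -> : (T - t = (T - t.+1).+1)%N by lia.
rewrite [X in _ <= X.2 i]/=.
have -> : (T - (T - t.+1).+1 = t)%N by lia.
exact: sweep_homo.
Qed.

Lemma prices_step t : (t < T)%N ->
  \sum_(i < n) (kp i)%:R * (prices (T - t)).2 i =
  \sum_(i < n) (kp i)%:R * (prices (T - t.+1)).2 i +
  \sum_(j < m) pt t j * margin t j.
Proof.
move=> tT; rewrite /margin /price_before.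
have e : (T - t = (T - t.+1).+1)%N by lia.
rewrite {1}e [X in X.2]/=.
have -> : (T - (T - t.+1).+1 = t)%N by lia.
rewrite sweep_sum; congr (_ + _); apply: eq_bigr => j _.
by rewrite e.
Qed.

(** Telescoping: the two halves of the dual objective are equal. *)
Lemma prices_sum :
  \sum_(i < n) (kp i)%:R * (prices T).2 i =
  \sum_(t < T) \sum_(j < m) pt t j * margin t j.
Proof.
(* For the induction, only the last q steps are counted. *)
suff H q : (q <= T)%N -> \sum_(i < n) (kp i)%:R * (prices q).2 i =
    \sum_(t < T | (T - q <= t)%N) \sum_(j < m) pt t j * margin t j.
  by rewrite H // subnn.
elim: q => [_|q IH qT].
  rewrite subn0 big1 => [|i _]; last by rewrite mulr0.
  by rewrite big_pred0 // => t; rewrite leqNgt ltn_ord.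
have tT : (T - q.+1 < T)%N by lia.
have := prices_step tT.
have -> : (T - (T - q.+1) = q.+1)%N by lia.
have -> : (T - (T - q.+1).+1 = q)%N by lia.
move=> ->; rewrite IH; last by lia.
rewrite [in RHS](bigD1 (Ordinal tT)) //= addrC; congr (_ + _).
apply: eq_bigl => t; rewrite -val_eqE /=; lia.
Qed.

(** The margin bounds [S * r] minus the price of i at the time of the scan; the final price is at
    least that price. *)
Lemma dual_feasible t i j : (t < T)%N -> (i < n)%N -> (j <= m)%N ->
  (prices (T - t)).1 * rw i j <= (prices T).2 i + margin t j.
Proof.
move=> tT im jn; rewrite -lerBlDl.
apply: le_trans (scan_ub _ _ _ im); rewrite lerD2l lerN2.
apply: le_trans (price_before_le _ tT jn) _.
by apply: prices_homo; lia.
Qed.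

End Prices.

(** * The decision process *)

(** Data indexed by ordinals are extended to all naturals by a default value, so that the price
    recursion, like the machine, works with plain numbers. *)
Definition ext (A : Type) (a : A) k (f : 'I_k -> A) (i : nat) : A :=
  oapp f a (insub i).

Lemma ext_ord (A : Type) (a : A) k (f : 'I_k -> A) (i : 'I_k) : ext a f i = f i.
Proof. by rewrite /ext valK. Qed.

Lemma ext_nat (A : Type) (a : A) k (f : 'I_k -> A) i (ik : (i < k)%N) :
  ext a f i = f (Ordinal ik).
Proof. by rewrite -(ext_ord a f (Ordinal ik)). Qed.

Definition rwd (F : numDomainType) n m T (I : instance F n m T) i j : F :=
  ext 0 (fun i => ext 0 (reward I i) j) i.
Definition dmd (F : numDomainType) n m T (I : instance F n m T) d : F :=
  ext 0 (demand I) d.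
Definition ptd (F : numDomainType) n m T (I : instance F n m T) t j : F :=
  ext 0 (fun t => ext 0 (ptype I t) j) t.
Definition capd (F : Type) n m T (I : instance F n m T) i : nat :=
  ext 0%N (cap I) i.

Lemma sum_tuple_cons (F : numDomainType) (E : finType) k
    (G : k.+1.-tuple E -> F) :
  \sum_x G x = \sum_e \sum_(x : k.-tuple E) G (cons_tuple e x).
Proof.
rewrite pair_big /= (reindex (fun p : E * k.-tuple E => cons_tuple p.1 p.2)) //=.
exists (fun x => (thead x, behead_tuple x)) => [[e x] _|x _] /=.
  by congr pair; apply/val_inj.
by rewrite [RHS]tuple_eta; apply/val_inj.
Qed.

Section Process.
Variables (F : realFieldType) (n m T : nat) (I : instance F n m T).
Variable pi : policy F n m.
Hypothesis vI : valid I.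
Hypothesis onl : online I pi.
Local Notation ev := ('I_m * option 'I_n)%type.

Definition weight (h : seq (event n m)) (e : ev) : F :=
  ptd I (size h) e.1 * pi h e.1 e.2.

(* Expected sum of [f t (event of step t)] over the [k] steps following [h]. *)
Fixpoint total (f : nat -> ev -> F) (k : nat) (h : seq (event n m)) : F :=
  if k is k'.+1 then
    \sum_(e : ev) weight h e * (f (size h) e + total f k' (rcons h e))
  else 0.

Lemma ptd_ge0 t j : 0 <= ptd I t j.
Proof.
case: vI => _ _ p0 _ _; rewrite /ptd /ext.
by case: (insub t) => //= t'; case: (insub j) => //=.
Qed.

Lemma weight_ge0 h e : 0 <= weight h e.
Proof. by rewrite mulr_ge0 ?ptd_ge0 //; case: (onl h e.1). Qed.

Lemma weight_used h e i : (cap I i <= used h i)%N -> e.2 = Some i -> weight h e = 0.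
Proof.
by rewrite /weight => ci ->; case: (onl h e.1) => _ _ ->; rewrite ?mulr0.
Qed.

Lemma sum_weight_type h (G : 'I_m -> F) :
  \sum_(e : ev) weight h e * G e.1 = \sum_(j < m) ptd I (size h) j * G j.
Proof.
transitivity (\sum_(j < m) \sum_a weight h (j, a) * G j).
  by rewrite pair_bigA; apply: eq_bigr => -[].
apply: eq_bigr => j _.
rewrite /weight -big_distrl /= -big_distrr /=.
by case: (onl h j) => _ -> _; rewrite mulr1.
Qed.

Lemma weight_sum h : (size h < T)%N -> \sum_(e : ev) weight h e = 1.
Proof.
move=> hT; case: vI => _ _ _ p1 _; rewrite -(p1 (Ordinal hT)).
have := sum_weight_type h (fun=> 1).
under eq_bigr do rewrite mulr1; move=> ->.
by apply: eq_bigr => j _; rewrite mulr1 /ptd ext_nat ext_ord.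
Qed.

Lemma total_ge0 f k h : (forall t e, 0 <= f t e) -> 0 <= total f k h.
Proof.
move=> f0; elim: k h => //= k IH h; apply: sumr_ge0 => e _.
by rewrite mulr_ge0 ?weight_ge0 // addr_ge0.
Qed.

Lemma eq_total f g k h :
  (forall t e, (size h <= t < size h + k)%N -> f t e = g t e) ->
  total f k h = total g k h.
Proof.
elim: k h => //= k IH h fg; apply: eq_bigr => e _; rewrite fg; last by lia.
by rewrite IH // => t e'; rewrite size_rcons => H; apply: fg; lia.
Qed.

Lemma total_sum (A : finType) (c : A -> F) (f : A -> nat -> ev -> F) k h :
  total (fun t e => \sum_a c a * f a t e) k h = \sum_a c a * total (f a) k h.
Proof.
elim: k h => [|k IH] h /=; first by rewrite big1 // => a _; rewrite mulr0.
under eq_bigr => e _.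
  rewrite IH -big_split big_distrr /=.
  under eq_bigr => a _ do rewrite -mulrDr mulrCA.
  over.
by rewrite exchange_big; apply: eq_bigr => a _; rewrite big_distrr.
Qed.

Definition cont_prob k (h : seq (event n m)) (x : k.-tuple ev) : F :=
  \prod_(t < k) weight (h ++ take t x) (tnth x t).

Lemma cont_prob_cons k h e (x : k.-tuple ev) :
  cont_prob h (cons_tuple e x) = weight h e * cont_prob (rcons h e) x.
Proof.
rewrite /cont_prob big_ord_recl /= cats0; congr (_ * _).
by apply: eq_bigr => t _; rewrite tnthS /= cat_rcons.
Qed.

Lemma cont_prob_sum k h : (size h + k <= T)%N ->
  \sum_(x : k.-tuple ev) cont_prob h x = 1.
Proof.
elim: k h => [|k IH] h hT.
  rewrite (big_pred1 [tuple]) => [|x]; last first.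
    by apply/esym/eqP/val_inj; rewrite [x]tuple0.
  by rewrite /cont_prob big_ord0.
rewrite sum_tuple_cons -[RHS](weight_sum (h := h)); last by lia.
apply: eq_bigr => e _.
under eq_bigr do rewrite cont_prob_cons.
by rewrite -big_distrr /= IH ?mulr1 // size_rcons; lia.
Qed.

(** Passes from sums over whole runs, as in [ALG], to the recursion on the first event, which suits
    induction. *)
Lemma total_expect (f : nat -> ev -> F) k h : (size h + k <= T)%N ->
  \sum_(x : k.-tuple ev)
    cont_prob h x * \sum_(t < k) f (size h + t)%N (tnth x t) = total f k h.
Proof.
elim: k h => [|k IH] h hT.
  by rewrite big1 // => x _; rewrite big_ord0 mulr0.
rewrite sum_tuple_cons [RHS]/=; apply: eq_bigr => e _.
rewrite mulrDr -IH; last by rewrite size_rcons; lia.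
have hT' : (size (rcons h e) + k <= T)%N by rewrite size_rcons; lia.
(* The immediate term is spread over all continuations, whose probabilities sum to 1. *)
rewrite -[X in X * f _ _]mulr1 -(cont_prob_sum hT') mulrAC !big_distrr -big_split.
apply: eq_bigr => x _; rewrite cont_prob_cons big_ord_recl addn0 /=.
rewrite !mulrDr mulrAC; congr (_ + _); rewrite mulrA; congr (_ * _).
by apply: eq_bigr => t _; rewrite tnthS size_rcons addSnnS.
Qed.

Definition surv t : F := \sum_(d < T.+1 | (t < d)%N) demand I d.

(** The policy does not see the horizon, so every run may be continued up to step T; the gain of
    step t then counts with the probability that the step takes place. *)
Lemma ALG_total : ALG I pi = total (fun t e => surv t * gain I e) T [::].
Proof.
have H k h : (size h + k = T)%N ->
    \sum_(d < T.+1) demand I d * total (fun _ => gain I) (d - size h)%N h =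
    total (fun t e => surv t * gain I e) k h.
  elim: k h => [|k IH] h hT.
    rewrite big1 // => d _; have -> : (d - size h = 0)%N.
      by have := ltn_ord d; lia.
    by rewrite mulr0.
  (* Horizons not exceeding [size h] have no step left and contribute 0; the others unfold by one
     step. *)
  transitivity (\sum_(d < T.+1) \sum_(e : ev) weight h e * (demand I d *
      (if (size h < d)%N then
         gain I e + total (fun _ => gain I) (d - (size h).+1)%N (rcons h e)
       else 0))).
    apply: eq_bigr => d _; case: ltnP => hd.
      have -> : (d - size h = (d - (size h).+1).+1)%N by lia.
      by rewrite big_distrr; apply: eq_bigr => e _; rewrite mulrCA.
    have -> : (d - size h = 0)%N by lia.
    by rewrite big1 ?mulr0 // => e _; rewrite !mulr0.
  rewrite exchange_big [RHS]/=; apply: eq_bigr => e _; rewrite -big_distrr /=.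
  congr (_ * _); rewrite -IH; last by rewrite size_rcons; lia.
  rewrite /surv big_distrl [in RHS]big_mkcond /= -big_split /=.
  apply: eq_bigr => d _; rewrite size_rcons; case: ltnP => hd.
    by rewrite mulrDr.
  have -> : (d - (size h).+1 = 0)%N by lia.
  by rewrite /= !mulr0 addr0.
rewrite -(H T [::]) //; apply: eq_bigr => d _; congr (_ * _).
rewrite subn0 -total_expect; last by rewrite add0n -ltnS.
apply: eq_bigr => x _; congr (_ * _); apply: eq_bigr => t _.
rewrite /weight /ptd /= size_take size_tuple ltn_ord.
by rewrite (ext_ord _ _ (widen_ord (leq_ord d) t)) ext_ord.
Qed.

Lemma ALG_ge0 : 0 <= ALG I pi.
Proof.
rewrite ALG_total; apply: total_ge0 => t e; case: vI => _ r0 _ _ [d0 _ _].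
rewrite mulr_ge0 //; first by apply: sumr_ge0.
by rewrite /gain; case: e.2.
Qed.

(* Probability of matching a query of type j to resource i at step t, when
   all T steps take place. *)
Definition occupation (t : 'I_T) (i : 'I_n) (j : 'I_m) : F :=
  total (fun t' e => ((t == t' :> nat) && (e == (j, Some i)))%:R) T [::].

Lemma occupation_objective : ALG I pi = lp_objective I occupation.
Proof.
rewrite ALG_total /lp_objective pair_big pair_big /= -total_sum.
apply: eq_total => t e /andP[_]; rewrite add0n => tT.
(* An unmatched query selects no term of the triple sum, a match at step t selects exactly one. *)
case: e => j [i|]; rewrite /gain /=; last first.
  by rewrite mulr0 big1 // => -[[i j'] t'] _ /=; rewrite xpair_eqE andbF andbF mulr0.
rewrite (bigD1 ((i, j), Ordinal tT)) //= !eqxx mulr1 big1 ?addr0 //.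
move=> [[i' j'] t']; rewrite !xpair_eqE /= => ne.
suff -> : (t' == t :> nat) && ((j == j') && (Some i == Some i')) = false.
  by rewrite mulr0.
apply: contraNF ne => /and3P[/eqP tt /eqP -> /eqP[->]].
by rewrite !eqxx /=; apply/eqP/val_inj.
Qed.

Lemma used_rcons (h : seq (event n m)) e i :
  used (rcons h e) i = (used h i + (e.2 == Some i))%N.
Proof. by rewrite /used -cats1 count_cat /= addn0. Qed.

(** Remaining capacity is a potential: a match to i lowers it by one, and has probability 0 once it
    has reached 0. *)
Lemma total_capacity i k h : (size h + k <= T)%N -> (used h i <= cap I i)%N ->
  total (fun _ e => (e.2 == Some i)%:R) k h <= (cap I i - used h i)%N%:R.
Proof.
elim: k h => //= k IH h hT ui.
have sumE b : b = b * \sum_(e : ev) weight h e.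
  by rewrite weight_sum ?mulr1 //; lia.
rewrite [leRHS]sumE big_distrr; apply: ler_sum => e _ /=; rewrite [leRHS]mulrC.
case: (boolP ((e.2 == Some i) && (cap I i <= used h i)%N)).
  by move=> /andP[/eqP e2 ci]; rewrite (weight_used ci e2) !mul0r.
move=> H; rewrite ler_wpM2l ?weight_ge0 //.
have u' : (used (rcons h e) i <= cap I i)%N.
  by rewrite used_rcons; case: eqP H => //=; lia.
have hT' : (size (rcons h e) + k <= T)%N by rewrite size_rcons; lia.
have := IH _ hT' u'; rewrite -(lerD2l (e.2 == Some i)%:R) => /le_trans; apply.
rewrite -natrD ler_nat used_rcons; case: eqP H => //=; lia.
Qed.

(** The type at step t is drawn independently of the history. The case of a history already past t
    is included so that the induction goes through step t. *)
Lemma total_type (t : nat) (j : 'I_m) k h :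
  total (fun t' e => ((t == t' :> nat) && (e.1 == j))%:R) k h <=
  if (size h <= t)%N then ptd I t j else 0.
Proof.
elim: k h => [|k IH] h /=; first by case: ifP => // _; exact: ptd_ge0.
have [ht|ht|ht] := ltngtP t (size h).
- rewrite big1 // => e _ /=; have := IH (rcons h e); rewrite size_rcons.
  rewrite leqNgt ltnS ltnW //= => H; rewrite add0r; apply/eqP.
  rewrite mulf_eq0 [X in _ || X]eq_le H; apply/orP; right.
  by rewrite total_ge0 // => *; rewrite ler0n.
- have [hT|hT] := ltnP (size h) T.
    have sumE b : b = b * \sum_(e : ev) weight h e.
      by rewrite weight_sum ?mulr1.
    rewrite [leRHS]sumE big_distrr; apply: ler_sum => e _ /=.
    rewrite add0r [leRHS]mulrC ler_wpM2l ?weight_ge0 //.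
    by apply: le_trans (IH _) _; rewrite size_rcons ht.
  (* Beyond step T the default value 0 of [ptd] makes all weights vanish. *)
  rewrite big1 ?ptd_ge0 // => e _.
  rewrite /weight /ptd [ext _ _ _]/ext insubF ?mul0r //=.
  by rewrite ltnNge hT.
- under eq_bigr => e _.
    rewrite (_ : total _ _ _ = 0); last first.
      apply/eqP; rewrite eq_le; have := IH (rcons h e).
      rewrite size_rcons ht ltnn => ->.
      by rewrite total_ge0 // => *; rewrite ler0n.
    rewrite addr0.
    over.
  rewrite ht (sum_weight_type h (fun j' => (j' == j)%:R)) (bigD1 j) //= eqxx mulr1.
  by rewrite big1 ?addr0 // => j' /negbTE ->; rewrite mulr0.
Qed.

Lemma occupation_feasible : lp_feasible I occupation.
Proof.
split=> [i|j t|t i j].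
- have H : (used ([::] : seq (event n m)) i <= cap I i)%N by [].
  have := total_capacity (k := T) (h := [::]) (leqnn T) H; rewrite subn0; apply: le_trans.
  rewrite pair_big /=.
  under eq_bigr => a _ do rewrite -[occupation _ _ _]mul1r.
  rewrite -total_sum le_eqVlt; apply/orP; left; apply/eqP/eq_total.
  move=> t [j a] /andP[_]; rewrite add0n /= => tT.
  case: (a =P Some i) => [->|ai]; last first.
    rewrite big1 // => -[j' t'] _ /=; rewrite xpair_eqE mul1r.
    by move/eqP/negbTE: ai => ->; rewrite !andbF.
  rewrite (bigD1 (j, Ordinal tT)) //= !eqxx mulr1 big1 ?addr0 //.
  move=> [j' t']; rewrite !xpair_eqE /= mul1r => ne.
  suff -> : (t' == t :> nat) && ((j == j') && (Some i == Some i)) = false by [].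
  apply: contraNF ne => /and3P[/eqP tt /eqP -> _].
  by rewrite eqxx /=; apply/eqP/val_inj.
- have H := total_type t j T [::].
  rewrite /= /ptd !ext_ord in H; apply: le_trans H.
  under eq_bigr => a _ do rewrite -[occupation _ _ _]mul1r.
  rewrite -total_sum.
  have le_total f g k h : (forall t e, f t e <= g t e) -> total f k h <= total g k h.
    move=> fg; elim: k h => //= k IH h; apply: ler_sum => e _.
    by rewrite ler_wpM2l ?weight_ge0 // lerD.
  (* Summed over resources, the indicators count a matched query once and an unmatched one not at
     all. *)
  apply: le_total => t' [j' [i|]]; rewrite /= ?xpair_eqE.
    rewrite (bigD1 i) //= big1 ?addr0 ?mul1r; last first.
      move=> i' ii; rewrite xpair_eqE (inj_eq Some_inj) (eq_sym i).
      by rewrite (negbTE ii) !andbF mulr0.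
    by rewrite xpair_eqE eqxx andbT.
  by rewrite big1 ?ler0n // => i _; rewrite xpair_eqE !andbF mulr0.
- by apply: total_ge0 => *; rewrite ler0n.
Qed.

End Process.

(** * The price policy *)

Section PricePolicy.
Variables (F : realFieldType) (n m T : nat) (I : instance F n m T).

Local Notation kp := (capd I).
Local Notation rw := (rwd I).
Local Notation dm := (dmd I).
Local Notation pt := (ptd I).
Local Notation prices := (prices n m T kp rw dm pt).
Local Notation choice := (best_choice n m T kp rw dm pt).
Local Notation margin := (margin n m T kp rw dm pt).
Local Notation price_before := (price_before n m T kp rw dm pt).

Definition decision (h : seq (event n m)) (j : 'I_m) : option 'I_n :=
  if choice (size h) j is c.+1 then
    obind (fun i => if (used h i < cap I i)%N then Some i else None) (insub c)
  else None.

Definition price_policy : policy F n m := fun h j a => (a == decision h j)%:R.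

Lemma online_price_policy : online I price_policy.
Proof.
move=> h j; split=> [a||i ci].
- exact: ler0n.
- rewrite (bigD1 (decision h j)) //= /price_policy eqxx big1 ?addr0 //.
  by move=> a /negbTE ->.
- rewrite /price_policy /decision; case: (choice _ _) => // c.
  case: (insub c) => //= i'; case: ifP => // ui.
  by case: eqP => // -[ii]; move: ui; rewrite -ii ltnNge ci.
Qed.

Lemma weight_price_policy h (G : 'I_m * option 'I_n -> F) :
  \sum_e weight I price_policy h e * G e =
  \sum_(j < m) pt (size h) j * G (j, decision h j).
Proof.
transitivity (\sum_(j < m) \sum_a weight I price_policy h (j, a) * G (j, a)).
  by rewrite pair_bigA; apply: eq_bigr => -[].
apply: eq_bigr => j _; rewrite (bigD1 (decision h j)) //= big1 ?addr0.
  by rewrite /weight /price_policy eqxx mulr1.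
by move=> a /negbTE ad; rewrite /weight /price_policy ad mulr0 mul0r.
Qed.

Hypothesis vI : valid I.

Let kp0 i : (i < n)%N -> (0 < kp i)%N.
Proof. by case: vI => c0 _ _ _ _ iN; rewrite /capd ext_nat. Qed.

Let pt0 t j : 0 <= pt t j. Proof. exact: ptd_ge0. Qed.

Lemma prices_surv q : (q <= T)%N -> (prices q).1 = surv I (T - q).
Proof.
elim: q => [_|q IH qT] /=.
  by rewrite /surv subn0 big_pred0 // => d; have := ltn_ord d; lia.
rewrite IH; last by lia.
have dT : (T - q < T.+1)%N by lia.
rewrite /surv [RHS](bigD1 (Ordinal dT)) /=; last by lia.
rewrite /dmd ext_nat addrC; congr (_ + _).
by apply: eq_bigl => d; rewrite -val_eqE /=; lia.
Qed.

(** Treating type j with best resource c raises the potential by [x c / k c] times the margin. If c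
    is exhausted, this is 0. Otherwise the match earns [S * r] and gives up one unit valued at the
    price mu of the later steps; this net gain is at least the margin, because the margin was taken
    against a price that earlier types of the same step can only have raised above mu. *)
Lemma price_policy_total k h : (size h + k = T)%N ->
  (forall i, used h i <= cap I i)%N ->
  \sum_i (cap I i - used h i)%:R * (prices k).2 i <=
  total I price_policy (fun t e => surv I t * gain I e) k h.
Proof.
elim: k h => [|k IH] h hT uh.
  by rewrite big1 // => i _; rewrite mulr0.
have sT : (size h < T)%N by lia.
have kE : (k = T - (size h).+1)%N by lia.
have k1E : (k.+1 = T - size h)%N by lia.
set mu := (prices k).2.
set x := fun i : 'I_n => (cap I i - used h i)%N%:R : F.
(* The type probabilities sum to 1, so the potential becomes an average over the next type, to be
   compared type by type. *)
have -> : \sum_i x i * (prices k.+1).2 i = \sum_(j < m) pt (size h) j *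
    (\sum_i x i * mu i +
     \sum_(i < n) (i.+1 == choice (size h) j)%:R * (x i / (kp i)%:R * margin (size h) j)).
  under eq_bigr => i _.
    rewrite [X in _ * X](_ : _ = mu i + \sum_(j < m) (i.+1 == choice (size h) j)%:R *
        (pt (size h) j / (kp i)%:R * margin (size h) j)); last first.
      rewrite /margin /best_choice /price_before -k1E -kE -/mu /=.
      have -> : (T - k.+1 = size h)%N by lia.
      by rewrite sweep_delta.
    rewrite mulrDr big_distrr.
    over.
  rewrite big_split exchange_big /=.
  under [RHS]eq_bigr do rewrite mulrDr.
  rewrite big_split -big_distrl /=.
  have -> : \sum_(j < m) pt (size h) j = 1.
    case: vI => _ _ _ p1 _; rewrite -(p1 (Ordinal sT)).
    by apply: eq_bigr => j _; rewrite /ptd ext_nat ext_ord.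
  rewrite mul1r; congr (_ + _); apply: eq_bigr => j _.
  by rewrite big_distrr; apply: eq_bigr => i _ /=; ring.
rewrite [total _ _ _ _ _]/= weight_price_policy; apply: ler_sum => j _.
rewrite ler_wpM2l //; set c := decision h j.
have IHj : (forall i, used (rcons h (j, c)) i <= cap I i)%N ->
    \sum_i (cap I i - used (rcons h (j, c)) i)%:R * mu i <=
    total I price_policy (fun t e => surv I t * gain I e) k (rcons h (j, c)).
  by apply: IH; rewrite size_rcons; lia.
(* Without a positive margin no price is raised and the query stays unmatched. *)
case E: (choice (size h) j) (erefl c) => [|a]; rewrite {2}/c /decision E => cE.
  rewrite [X in _ + X]big1 => [|i _]; last by rewrite mul0r.
  rewrite addr0 /gain cE mulr0 add0r -cE.
  have ur i : used (rcons h (j, c)) i = used h i by rewrite used_rcons cE addn0.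
  by under eq_bigr => i _ do rewrite /x -ur; apply: IHj => i; rewrite ur.
have [an margE marg0] := scan_some E.
pose i0 := Ordinal an.
have {}cE : c = if (used h i0 < cap I i0)%N then Some i0 else None.
  by rewrite cE (insubT (fun i => i < n)%N an).
rewrite [X in _ + X](bigD1 i0) //= eqxx mul1r [X in _ + (_ + X)]big1 ?addr0; last first.
  move=> i ii0; case: eqP => [ia|_]; last by rewrite mul0r.
  by case/eqP: ii0; apply/val_inj; case: ia.
(* If the best resource is exhausted, its remaining capacity 0 cancels the raise. *)
move: (uh i0); rewrite leq_eqVlt => /orP[/eqP u0|u0].
  rewrite u0 ltnn in cE.
  rewrite {2}/x u0 subnn !mul0r addr0 /gain cE mulr0 add0r -cE.
  have ur i : used (rcons h (j, c)) i = used h i by rewrite used_rcons cE addn0.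
  by under eq_bigr => i _ do rewrite /x -ur; apply: IHj => i; rewrite ur.
rewrite u0 in cE.
have ur i : used (rcons h (j, c)) i = (used h i + (i == i0))%N.
  by rewrite used_rcons cE (inj_eq Some_inj) eq_sym.
have ur' i : (used (rcons h (j, c)) i <= cap I i)%N.
  by rewrite ur; case: eqP => [->|_]; rewrite ?addn1 // addn0.
apply: le_trans (lerD (lexx _) (IHj ur')).
have -> : \sum_i (cap I i - used (rcons h (j, c)) i)%:R * mu i =
    \sum_i x i * mu i - mu i0.
  rewrite [LHS](bigD1 i0) //= [in RHS](bigD1 i0) //= addrAC; congr (_ + _).
    by rewrite ur eqxx subnDA natrB ?subn_gt0 // mulrBl mul1r.
  by apply: eq_bigr => i /negbTE ii0; rewrite ur ii0 addn0.
rewrite addrCA lerD2l.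
have marg_le : margin (size h) j <= surv I (size h) * gain I (j, c) - mu i0.
  rewrite /margin margE prices_surv; last by lia.
  rewrite subKn; last by lia.
  rewrite /gain cE /= /rwd ext_nat ext_ord lerD2l lerN2.
  by rewrite /mu kE; apply: sweep_ge.
(* The ratio of remaining to full capacity is at most 1. *)
apply: le_trans marg_le; rewrite ler_piMl ?(ltW marg0) //.
rewrite ler_pdivrMr ?ltr0n ?kp0 // mul1r ler_nat /capd ext_nat; exact: leq_subr.
Qed.

Lemma price_policy_bound :
  \sum_(i < n) (kp i)%:R * (prices T).2 i <= ALG I price_policy.
Proof.
rewrite (ALG_total vI online_price_policy).
have := @price_policy_total T [::] erefl (fun=> leq0n _); apply: le_trans.
rewrite le_eqVlt; apply/orP; left; apply/eqP/eq_bigr => i _.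
by rewrite subn0 /capd ext_ord.
Qed.

(** Weak duality for the final prices and the margins; the factor 2 comes from the equal halves in
    [prices_sum]. *)
Lemma lp_weak_duality y : lp_feasible I y ->
  lp_objective I y <= 2 * \sum_(i < n) (kp i)%:R * (prices T).2 i.
Proof.
move=> [ycap yp y0].
have mu0 i : 0 <= (prices T).2 i.
  by apply: (prices_homo n m T kp rw dm pt0 i (leq0n T)).
have step : lp_objective I y <= \sum_(i < n) \sum_(j < m) \sum_(t < T)
    ((prices T).2 i * y t i j + margin t j * y t i j).
  rewrite /lp_objective; apply: ler_sum => i _; apply: ler_sum => j _.
  apply: ler_sum => t _; rewrite -mulrDl ler_wpM2r //.
  have := @dual_feasible _ n m T kp rw dm pt pt0 t i j (ltn_ord t) (ltn_ord i).
  move=> /(_ (ltnW (ltn_ord j))); rewrite prices_surv ?leq_subr //.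
  by rewrite subKn ?(ltnW (ltn_ord t)) // /rwd !ext_ord.
apply: le_trans step _.
rewrite mulrDl mul1r.
under eq_bigr => i _ do under eq_bigr => j _ do rewrite big_split.
under eq_bigr => i _ do rewrite big_split /=.
rewrite big_split /=; apply: lerD.
  apply: ler_sum => i _.
  under eq_bigr => j _ do rewrite -big_distrr /=.
  by rewrite -big_distrr /= mulrC ler_wpM2r // /capd ext_ord.
rewrite prices_sum // exchange_big /=.
under eq_bigr => j _ do rewrite exchange_big /=.
rewrite exchange_big /=; apply: ler_sum => t _; apply: ler_sum => j _.
rewrite -big_distrr /= mulrC ler_wpM2r ?scan_ge0 //.
by apply: le_trans (yp j t) _; rewrite /ptd !ext_ord.
Qed.

End PricePolicy.

(** * Layout of the input *)

Lemma nth_cat_skip (A : Type) (a : A) s1 s2 k c : c = size s1 ->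
  nth a (s1 ++ s2) (c + k) = nth a s2 k.
Proof. by move=> ->; rewrite nth_cat ltnNge leq_addr /= addKn. Qed.

Lemma nth_cat_keep (A : Type) (a : A) s1 s2 k : (k < size s1)%N ->
  nth a (s1 ++ s2) k = nth a s1 k.
Proof. by rewrite nth_cat => ->. Qed.

Lemma nth_allpairs (A B C : Type) (a : A) (b : B) (c : C) (f : A -> B -> C)
    (s : seq A) (t : seq B) i j : (i < size s)%N -> (j < size t)%N ->
  nth c [seq f x y | x <- s, y <- t] (i * size t + j) = f (nth a s i) (nth b t j).
Proof.
elim: s i => // x s IH [|i] /= iS jt.
  by rewrite nth_cat_keep ?size_map // (nth_map b).
by rewrite mulSn -addnA nth_cat_skip ?size_map // IH.
Qed.

Lemma nth_enum_ord_val k (i : 'I_k) (d : 'I_k) : nth d (enum 'I_k) i = i.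
Proof. by apply/val_inj; rewrite /= nth_enum_ord. Qed.

Definition rats (s : seq rat) : seq nat := flatten [seq encode_rat x | x <- s].

Section Rats.
Local Open Scope nat_scope.

Lemma size_rats s : size (rats s) = (2 * size s)%N.
Proof. by elim: s => //= x s IH; rewrite IH; lia. Qed.

Lemma nth_rats s k : (k < size s)%N ->
  nth 0%N (rats s) (2 * k) = `|numq (nth 0%R s k)|%N /\
  nth 0%N (rats s) (2 * k + 1) = `|denq (nth 0%R s k)|%N.
Proof.
elim: s k => // x s IH [|k] // ks.
by have [<- <-] := IH k ks; rewrite mulnS.
Qed.

Lemma nth_pairs (A : Type) (f g : A -> nat) (s : seq A) (a : A) k : (k < size s)%N ->
  nth 0%N (flatten [seq [:: f x; g x] | x <- s]) (2 * k + 1) = g (nth a s k).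
Proof.
by elim: s k => // x s IH [|k] // ks; rewrite -(IH k ks) mulnS.
Qed.

End Rats.

Section Layout.
Local Open Scope nat_scope.
Variables (n m T : nat) (I : instance rat n m T) (h : seq (event n m)) (j0 : 'I_m).

(** Start addresses of the successive tables: three header cells, one cell per capacity, two cells
    per rational; the history is its length followed by two cells per event. *)
Definition reward_addr : nat := 3 + n.
Definition demand_addr : nat := reward_addr + 2 * (n * m).
Definition ptype_addr : nat := demand_addr + 2 * T.+1.
Definition history_addr : nat := ptype_addr + 2 * (T * m).
Definition type_addr : nat := history_addr + (1 + 2 * size h).
Definition work_addr : nat := type_addr + 1.

Definition rewards : seq rat := [seq reward I i j | i <- enum 'I_n, j <- enum 'I_m].
Definition ptypes : seq rat := [seq ptype I t j | t <- enum 'I_T, j <- enum 'I_m].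
Definition demands : seq rat := [seq demand I d | d <- enum 'I_T.+1].

Lemma encode_instanceE : encode_instance I =
  [:: n; m; T] ++ [seq cap I i | i <- enum 'I_n] ++ rats rewards ++
  rats demands ++ rats ptypes.
Proof.
by rewrite /encode_instance /rats /rewards /ptypes /demands !map_allpairs -map_comp.
Qed.

Local Notation inp := (initial_memory I h j0).

Lemma size_history : size (encode_history h) = (1 + 2 * size h)%N.
Proof. by rewrite /encode_history /=; elim: h => //= e s IH; lia. Qed.

Lemma size_rewards : size rewards = (n * m)%N.
Proof. by rewrite size_allpairs !size_enum_ord. Qed.

Lemma size_ptypes : size ptypes = (T * m)%N.
Proof. by rewrite size_allpairs !size_enum_ord. Qed.

Lemma size_demands : size demands = T.+1.
Proof. by rewrite size_map size_enum_ord. Qed.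

Lemma size_caps : size [seq cap I i | i <- enum 'I_n] = n.
Proof. by rewrite size_map size_enum_ord. Qed.

Lemma size_instance : size (encode_instance I) = history_addr.
Proof.
rewrite encode_instanceE !size_cat !size_rats size_rewards size_demands size_ptypes.
by rewrite size_map size_enum_ord /history_addr /ptype_addr /demand_addr
  /reward_addr /=; lia.
Qed.

Lemma inpE : inp = nth 0%N ([:: n; m; T] ++ [seq cap I i | i <- enum 'I_n] ++
  rats rewards ++ rats demands ++ rats ptypes ++ encode_history h ++ [:: val j0]).
Proof. by rewrite /initial_memory encode_instanceE -!catA. Qed.

Lemma inp_n : inp 0 = n. Proof. by rewrite inpE. Qed.
Lemma inp_m : inp 1 = m. Proof. by rewrite inpE. Qed.
Lemma inp_T : inp 2 = T. Proof. by rewrite inpE. Qed.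

Lemma inp_cap i : (i < n)%N -> inp (3 + i) = capd I i.
Proof.
move=> iN; rewrite inpE nth_cat_skip // nth_cat_keep ?size_caps //.
rewrite (nth_map (Ordinal iN)) ?size_enum_ord // /capd ext_nat.
by rewrite (nth_enum_ord_val (Ordinal iN)).
Qed.

Lemma inp_rewards k : inp (reward_addr + k) =
  nth 0 (rats rewards ++ rats demands ++ rats ptypes ++
         encode_history h ++ [:: val j0]) k.
Proof.
by rewrite inpE /reward_addr -addnA nth_cat_skip // nth_cat_skip ?size_caps.
Qed.

Lemma inp_demands k : inp (demand_addr + k) =
  nth 0 (rats demands ++ rats ptypes ++ encode_history h ++ [:: val j0]) k.
Proof.
rewrite /demand_addr -addnA inp_rewards nth_cat_skip //.
by rewrite size_rats size_rewards.
Qed.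

Lemma inp_ptypes k : inp (ptype_addr + k) =
  nth 0 (rats ptypes ++ encode_history h ++ [:: val j0]) k.
Proof.
rewrite /ptype_addr -addnA inp_demands nth_cat_skip //.
by rewrite size_rats size_demands.
Qed.

Lemma inp_reward i j : (i < n)%N -> (j < m)%N ->
  inp (reward_addr + 2 * (i * m + j)) = `|numq (rwd I i j)|%N /\
  inp (reward_addr + (2 * (i * m + j) + 1)) = `|denq (rwd I i j)|%N.
Proof.
move=> iN jM; have lt : (i * m + j < n * m)%N by nia.
have [] := @nth_rats rewards (i * m + j); first by rewrite size_rewards.
have E := @nth_allpairs _ _ _ (Ordinal iN) (Ordinal jM) 0%R (reward I)
  (enum 'I_n) (enum 'I_m) i j.
rewrite !size_enum_ord in E; rewrite E //.
rewrite (nth_enum_ord_val (Ordinal iN)) (nth_enum_ord_val (Ordinal jM)).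
rewrite /rwd ext_nat ext_nat => <- <-.
by rewrite !inp_rewards !nth_cat_keep // size_rats size_rewards; lia.
Qed.

Lemma inp_demand d : (d <= T)%N ->
  inp (demand_addr + 2 * d) = `|numq (dmd I d)|%N /\
  inp (demand_addr + (2 * d + 1)) = `|denq (dmd I d)|%N.
Proof.
move=> dT; have lt : (d < T.+1)%N by [].
have [] := @nth_rats demands d; first by rewrite size_demands.
rewrite (nth_map (Ordinal lt)) ?size_enum_ord // (nth_enum_ord_val (Ordinal lt)).
rewrite /dmd ext_nat => <- <-.
by rewrite !inp_demands !nth_cat_keep // size_rats size_demands; lia.
Qed.

Lemma inp_ptype t j : (t < T)%N -> (j < m)%N ->
  inp (ptype_addr + 2 * (t * m + j)) = `|numq (ptd I t j)|%N /\
  inp (ptype_addr + (2 * (t * m + j) + 1)) = `|denq (ptd I t j)|%N.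
Proof.
move=> tT jM; have lt : (t * m + j < T * m)%N by nia.
have [] := @nth_rats ptypes (t * m + j); first by rewrite size_ptypes.
have E := @nth_allpairs _ _ _ (Ordinal tT) (Ordinal jM) 0%R (ptype I)
  (enum 'I_T) (enum 'I_m) t j.
rewrite !size_enum_ord in E; rewrite E //.
rewrite (nth_enum_ord_val (Ordinal tT)) (nth_enum_ord_val (Ordinal jM)).
rewrite /ptd ext_nat ext_nat => <- <-.
by rewrite !inp_ptypes !nth_cat_keep // size_rats size_ptypes; lia.
Qed.

Lemma inp_history k : inp (history_addr + k) =
  nth 0%N (encode_history h ++ [:: val j0]) k.
Proof. by rewrite /initial_memory nth_cat_skip ?size_instance. Qed.

Lemma inp_size : inp history_addr = size h.
Proof. by rewrite -[history_addr]addn0 inp_history. Qed.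

Lemma inp_event s e : (s < size h)%N ->
  inp (history_addr + (2 * s + 2)) = encode_decision (nth e h s).2.
Proof.
move=> sh; rewrite inp_history nth_cat_keep; last by rewrite size_history; lia.
rewrite (_ : (2 * s + 2 = (2 * s + 1).+1)%N) /=; last by lia.
exact: (@nth_pairs _ (fun e => nat_of_ord e.1) (fun e => encode_decision e.2)).
Qed.

Lemma inp_type : inp type_addr = j0.
Proof.
by rewrite /type_addr inp_history -[(1 + _)%N]addn0 nth_cat_skip ?size_history.
Qed.

(** Registers and array thus start at zero. *)
Lemma inp_beyond a : (work_addr <= a)%N -> inp a = 0%N.
Proof.
move=> ha; rewrite /initial_memory nth_default //.
rewrite size_cat size_instance size_cat size_history.
by move: ha; rewrite /work_addr /type_addr /=; lia.
Qed.

(** Every cell has bit length at least 1. This bounds n, m, T and the loop counts by the bit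
    size. *)
Lemma size_bit_size : (history_addr <= bit_size I)%N.
Proof.
rewrite -size_instance /bit_size; elim: encode_instance => //= x s IH.
by rewrite big_cons -add1n leq_add.
Qed.

(** A cell of the instance is bounded through its own bit length; the history and the query hold
    only numbers at most n, m or T, all of which are at most the bit size. *)
Lemma inp_lt a : (size h < T)%N -> (inp a < 2 ^ bit_size I)%N.
Proof.
move=> hT; have hB := size_bit_size.
have small k : (k <= bit_size I)%N -> (k < 2 ^ bit_size I)%N.
  by move=> kB; apply: leq_ltn_trans kB (ltn_expl _ _).
have mB : (m <= bit_size I)%N.
  apply: leq_trans hB; rewrite /history_addr.
  have : (m <= T * m)%N by apply: leq_pmull; lia.
  by lia.
have nB : (n <= bit_size I)%N.
  apply: leq_trans hB.
  by rewrite /history_addr /ptype_addr /demand_addr /reward_addr; lia.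
have TB : (T <= bit_size I)%N.
  by apply: leq_trans hB; rewrite /history_addr /ptype_addr; lia.
have [aI|aI] := ltnP a (size (encode_instance I)).
  rewrite /initial_memory nth_cat_keep //.
  apply: leq_trans (ltn_bitlen _) _; rewrite leq_exp2l // /bit_size.
  by rewrite (big_rem (nth 0%N (encode_instance I) a)) ?mem_nth //= leq_addr.
rewrite -(subnKC aI) /initial_memory nth_cat_skip //; apply: small.
move: (a - _)%N => k.
have [kh|kh] := ltnP k (size (encode_history h)); last first.
  rewrite nth_cat ltnNge kh /=; case: (_ - _)%N => [|c] /=.
    by apply: leq_trans mB; apply: ltnW.
  by rewrite nth_nil.
rewrite nth_cat_keep // /encode_history; case: k kh => [|k] _ /=.
  by apply: leq_trans TB; apply: ltnW.
elim: h k => [|[j a'] s IH] [|[|k]] //=.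
  by apply: leq_trans mB; apply: ltnW.
by apply: leq_trans nB; case: a' => //= i.
Qed.

End Layout.

(** * The program *)

Definition w_n : wexpr := WI (WC 0).
Definition w_m : wexpr := WI (WC 1).
Definition w_T : wexpr := WI (WC 2).
Definition w_double (e : wexpr) : wexpr := WMul (WC 2) e.
Definition w_succ (e : wexpr) : wexpr := WAdd e (WC 1).
Definition w_pred (e : wexpr) : wexpr := WSub e (WC 1).
Definition w_dist (a b : wexpr) : wexpr := WAdd (WSub a b) (WSub b a).
Definition w_rewards : wexpr := WAdd (WC 3) w_n.
Definition w_demands : wexpr := WAdd w_rewards (w_double (WMul w_n w_m)).
Definition w_ptypes : wexpr := WAdd w_demands (w_double (w_succ w_T)).
Definition w_history : wexpr := WAdd w_ptypes (w_double (WMul w_T w_m)).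
Definition w_size : wexpr := WI w_history.
Definition w_type : wexpr :=
  WAdd w_history (WAdd (WC 1) (w_double w_size)).
Definition w_query : wexpr := WI w_type.
Definition w_work : wexpr := w_succ w_type.
Definition w_cap (i : wexpr) : wexpr := WI (WAdd (WC 3) i).
Definition w_num (table k : wexpr) : wexpr := WI (WAdd table (w_double k)).
Definition w_den (table k : wexpr) : wexpr :=
  WI (WAdd table (w_succ (w_double k))).
Definition w_cell (i j : wexpr) : wexpr := WAdd (WMul i w_m) j.
Definition w_event (k : wexpr) : wexpr :=
  WI (WAdd w_history (WAdd (w_double k) (WC 2))).

Arguments w_n : simpl never.
Arguments w_m : simpl never.
Arguments w_T : simpl never.
Arguments w_size : simpl never.
Arguments w_query : simpl never.
Arguments w_type : simpl never.
Arguments w_cap : simpl never.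
Arguments w_num : simpl never.
Arguments w_den : simpl never.
Arguments w_event : simpl never.

Definition work_expr : expr := compile_expr (Const 0) w_work.

(** The best margin so far is [r_gap_num] over [r_gap_den], reached by resource [r_best] minus one;
    [r_scale] is the factor of [r_gap_den] that does not come from the price. [r_ans] is the
    recorded choice and [r_count] the number of earlier matches to it. *)
Local Notation r_surv_num := 0%N.
Local Notation r_surv_den := 1%N.
Local Notation r_q := 2%N.
Local Notation r_j := 3%N.
Local Notation r_i := 4%N.
Local Notation r_gap_num := 5%N.
Local Notation r_gap_den := 6%N.
Local Notation r_best := 7%N.
Local Notation r_ans := 8%N.
Local Notation r_count := 9%N.
Local Notation r_t := 10%N.
Local Notation r_new_num := 11%N.
Local Notation r_new_scale := 12%N.
Local Notation r_scale := 13%N.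

(* The price of resource i is the quotient of the array cells 2i and 2i+1. *)
Definition w_price_num (i : wexpr) : wexpr := WA (w_double i).
Definition w_price_den (i : wexpr) : wexpr := WA (w_succ (w_double i)).

(** Numerators are already 0, so setting the denominators to 1 makes every price 0. *)
Definition p_init : prog :=
  PFor r_i w_n (PArr (w_succ (w_double (WR r_i))) (WC 1)).

Definition p_survival : prog :=
  PSeq (PSet r_t (WSub w_T (w_succ (WR r_q))))
  (PSeq (PSet r_surv_num
    (WAdd (WMul (WR r_surv_num) (w_den w_demands (WSub w_T (WR r_q))))
          (WMul (w_num w_demands (WSub w_T (WR r_q))) (WR r_surv_den))))
  (PSet r_surv_den
    (WMul (WR r_surv_den) (w_den w_demands (WSub w_T (WR r_q)))))).

(** Fractions are compared by cross multiplication. Truncated subtraction turns a negative margin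
    into 0, which never beats the current best. *)
Definition p_compare : prog :=
  PSeq (PSet r_new_scale (WMul (WR r_surv_den)
         (w_den w_rewards (w_cell (WR r_i) (WR r_j)))))
  (PSeq (PSet r_new_num (WSub
         (WMul (WMul (WR r_surv_num) (w_num w_rewards (w_cell (WR r_i) (WR r_j))))
               (w_price_den (WR r_i)))
         (WMul (WR r_new_scale) (w_price_num (WR r_i)))))
  (PIf (WSub (WMul (WR r_new_num) (WR r_gap_den))
             (WMul (WR r_gap_num) (WMul (WR r_new_scale) (w_price_den (WR r_i)))))
    (PSeq (PSet r_gap_num (WR r_new_num))
    (PSeq (PSet r_gap_den (WMul (WR r_new_scale) (w_price_den (WR r_i))))
    (PSeq (PSet r_scale (WR r_new_scale))
          (PSet r_best (w_succ (WR r_i))))))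
    PSkip)).

Definition p_scan : prog :=
  PSeq (PSet r_gap_num (WC 0)) (PSeq (PSet r_gap_den (WC 1))
  (PSeq (PSet r_best (WC 0)) (PFor r_i w_n p_compare))).

(** The denominator of the margin is [r_scale] times that of the price, so it already is a multiple
    of the latter, and the sum needs no product of the two. A naive addition of fractions would
    square the price denominator at each raise; here its length grows by a bounded amount. *)
Definition p_raise : prog :=
  let best := w_pred (WR r_best) in
  let cell := w_cell (WR r_t) (WR r_j) in
  PIf (WR r_best)
    (PSeq (PArr (w_double best)
       (WAdd (WMul (w_price_num best)
                (WMul (WMul (w_den w_ptypes cell) (w_cap best)) (WR r_scale)))
             (WMul (w_num w_ptypes cell) (WR r_gap_num))))
     (PArr (w_succ (w_double best))
       (WMul (WR r_gap_den) (WMul (w_den w_ptypes cell) (w_cap best)))))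
    PSkip.

(** One minus a distance, truncated, is nonzero exactly when the distance is 0, so the test
    recognizes the current step and query type. *)
Definition p_record : prog :=
  PIf (WSub (WC 1) (WAdd (w_dist (WR r_t) w_size) (w_dist (WR r_j) w_query)))
    (PSet r_ans (WR r_best)) PSkip.

Definition p_prices : prog :=
  PSeq p_init (PSeq (PSet r_surv_den (WC 1))
  (PFor r_q w_T (PSeq p_survival
    (PFor r_j w_m (PSeq p_scan (PSeq p_raise p_record)))))).

(** Counting past decisions with the code [r_ans] gives the used capacity of the chosen resource. If
    [r_ans] is 0, the answer remains 0. *)
Definition p_check : prog :=
  PSeq (PFor r_i w_size
         (PIf (WSub (WC 1) (w_dist (w_event (WR r_i)) (WR r_ans)))
           (PSet r_count (w_succ (WR r_count))) PSkip))
  (PIf (WR r_ans)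
    (PIf (WSub (w_cap (w_pred (WR r_ans))) (WR r_count))
      PSkip (PSet r_ans (WC 0)))
    PSkip).

Definition price_prog : prog := PSeq p_prices p_check.

Definition price_cmd : cmd :=
  Seq (compile work_expr price_prog)
      (Store (Const 0) (compile_expr work_expr (WR r_ans))).

Lemma price_prog_wf : wf price_prog && wf_exprs price_prog.
Proof. by []. Qed.

(** * Correctness of the program *)

(** The fraction need not be in lowest terms. *)
Definition rep (F : realFieldType) (a b : nat) (x : F) : Prop :=
  (0 < b)%N /\ x = a%:R / b%:R.

Lemma rep_ratr (F : realFieldType) (x : rat) : 0 <= x ->
  @rep F `|numq x|%N `|denq x|%N (ratr x).
Proof.
move=> x0; split; first by rewrite absz_gt0 denq_neq0.
by rewrite /ratr !pmulrn !gez0_abs ?numq_ge0 ?denq_ge0.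
Qed.

Lemma rep_lt (F : realFieldType) a b c d (x y : F) : rep a b x -> rep c d y ->
  (x < y) = (a * d < c * b)%N.
Proof.
move=> [b0 ->] [d0 ->]; rewrite ltr_pdivrMr ?ltr0n // mulrAC.
by rewrite ltr_pdivlMr ?ltr0n // -!natrM ltr_nat.
Qed.

Section MapInstance.
Variables (F : realFieldType) (n m T : nat) (I : instance rat n m T).
Local Notation IR := (map_instance (@ratr F) I).

Lemma rwd_map i j : rwd IR i j = ratr (rwd I i j).
Proof.
by rewrite /rwd /ext; case: (insub i) => /= [?|]; rewrite ?rmorph0 //;
  case: insub => /= [?|]; rewrite ?rmorph0.
Qed.

Lemma ptd_map t j : ptd IR t j = ratr (ptd I t j).
Proof.
by rewrite /ptd /ext; case: (insub t) => /= [?|]; rewrite ?rmorph0 //;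
  case: insub => /= [?|]; rewrite ?rmorph0.
Qed.

Lemma dmd_map d : dmd IR d = ratr (dmd I d).
Proof. by rewrite /dmd /ext; case: insub => /= [?|]; rewrite ?rmorph0. Qed.

End MapInstance.

Lemma rwd_ge0 (F : realFieldType) n m T (I : instance F n m T) i j :
  valid I -> 0 <= rwd I i j.
Proof.
case=> _ r0 _ _ _; rewrite /rwd /ext; case: (insub i) => //= ?.
by case: (insub j) => /=.
Qed.

Lemma dmd_ge0 (F : realFieldType) n m T (I : instance F n m T) d :
  valid I -> 0 <= dmd I d.
Proof. by case=> _ _ _ _ [d0 _ _]; rewrite /dmd /ext; case: (insub d). Qed.

(** The arithmetic behind [p_compare]. Since x is nonnegative, truncating a negative margin to 0
    leaves the outcome of the comparison unchanged. *)
Lemma rep_gap (F : realFieldType) a b c d N D G H (S r mu x : F) :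
  rep a b S -> rep c d r -> rep N D mu -> rep G H x ->
  (x < S * r - mu) = (G * (b * d * D) < (a * c * D - b * d * N) * H)%N /\
  (x < S * r - mu -> rep (a * c * D - b * d * N)%N (b * d * D)%N (S * r - mu)).
Proof.
move=> [b0 Sab] [d0 rcd] [D0 muND] repx.
have E : S * r - mu = ((a * c * D)%:R - (b * d * N)%:R) / (b * d * D)%:R.
  have n0 k : (0 < k)%N -> k%:R != 0 :> F by rewrite pnatr_eq0 lt0n.
  by rewrite Sab rcd muND !natrM; field; rewrite !n0.
have bdD : (0 < b * d * D)%N by rewrite !muln_gt0 b0 d0 D0.
have [le|lt] := leqP (b * d * N) (a * c * D).
  have R : rep (a * c * D - b * d * N) (b * d * D) (S * r - mu).
    by split=> //; rewrite E natrB.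
  by split=> //; rewrite (rep_lt repx R).
have x0 : 0 <= x by case: repx => _ ->; rewrite divr_ge0 ?ler0n.
have neg : S * r - mu < 0.
  by rewrite E pmulr_llt0 ?invr_gt0 ?ltr0n // subr_lt0 ltr_nat.
have -> : (x < S * r - mu) = false.
  by apply/negbTE; rewrite -leNgt (le_trans (ltW neg)).
by split=> //; rewrite (_ : a * c * D - _ = 0)%N ?mul0n //; lia.
Qed.

Lemma leq_pow2_mul x y a b : (x <= 2 ^ a)%N -> (y <= 2 ^ b)%N ->
  (x * y <= 2 ^ (a + b))%N.
Proof. by move=> xa yb; rewrite expnD leq_mul. Qed.

Lemma leq_pow2_add x y a : (x <= 2 ^ a)%N -> (y <= 2 ^ a)%N ->
  (x + y <= 2 ^ a.+1)%N.
Proof. by rewrite expnS; lia. Qed.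

Lemma leq_pow2_trans x a b : (x <= 2 ^ a)%N -> (a <= b)%N -> (x <= 2 ^ b)%N.
Proof. by move=> xa ab; apply: leq_trans xa _; rewrite leq_exp2l. Qed.

Lemma ltn_pow2_trans x a b : (x <= 2 ^ a)%N -> (a < b)%N -> (x < 2 ^ b)%N.
Proof. by move=> xa ab; apply: leq_ltn_trans xa _; rewrite ltn_exp2l. Qed.

(** * Simulation of the price recursion, with bit lengths of all fractions *)

Section Simulation.
Local Open Scope nat_scope.
Variables (F : realFieldType) (n m T : nat) (I : instance rat n m T).
Variables (h : seq (event n m)) (j0 : 'I_m).
Hypothesis vI : valid I.
Hypothesis hT : size h < T.

Local Notation IR := (map_instance (@ratr F) I).
Local Notation inp := (initial_memory I h j0).
Local Notation base := (work_addr T h).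
Local Notation B := (bit_size I).
Local Notation ev := (weval inp base).

(** The survival fraction grows by B bits for a denominator and one for the addition, in each of T
    <= B steps. A raise adds B bits each for a probability, a capacity and a reward, [surv_bits] for
    the survival probability, and one for the addition. At most B raises precede any given one, as T
    * m <= B. *)
Definition surv_bits : nat := (B + 1) * B.
Definition step_bits : nat := 3 * B + surv_bits + 1.
Definition total_bits : nat := step_bits * (B + 1) + 1.

Local Notation wp := (wpre inp base B total_bits).
Local Notation prices := (prices n m T (capd IR) (rwd IR) (dmd IR) (ptd IR)).
Local Notation scan := (scan_margins (rwd IR)).

Definition rn i j := `|numq (rwd I i j)|.
Definition rd i j := `|denq (rwd I i j)|.
Definition pn t j := `|numq (ptd I t j)|.
Definition pd t j := `|denq (ptd I t j)|.
Definition dn d := `|numq (dmd I d)|.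
Definition dd d := `|denq (dmd I d)|.

Lemma rep_reward i j : rep (rn i j) (rd i j) (rwd IR i j).
Proof. by rewrite rwd_map; apply: rep_ratr; exact: rwd_ge0. Qed.

Lemma rep_ptype t j : rep (pn t j) (pd t j) (ptd IR t j).
Proof. by rewrite ptd_map; apply: rep_ratr; exact: ptd_ge0. Qed.

Lemma rep_demand d : rep (dn d) (dd d) (dmd IR d).
Proof. by rewrite dmd_map; apply: rep_ratr; exact: dmd_ge0. Qed.

Lemma ev_input s a : a < base -> mem_of inp base s a = inp a.
Proof. by rewrite /mem_of => ->. Qed.

Lemma ev_n s : ev s w_n = n.
Proof. by rewrite /w_n /= ev_input ?inp_n // /work_addr addn1. Qed.

Lemma base_gt : 3 < base.
Proof.
by rewrite /work_addr /type_addr /history_addr /ptype_addr /demand_addr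
  /reward_addr; lia.
Qed.

Lemma ev_m s : ev s w_m = m.
Proof. by rewrite /w_m /= ev_input ?inp_m //; have := base_gt; lia. Qed.

Lemma ev_T s : ev s w_T = T.
Proof. by rewrite /w_T /= ev_input ?inp_T //; have := base_gt; lia. Qed.

Lemma ev_history s : ev s w_history = history_addr n m T.
Proof.
rewrite /w_history /w_ptypes /w_demands /w_rewards /w_double /w_succ.
cbn [weval]; rewrite ev_n ev_m ev_T /history_addr /ptype_addr /demand_addr.
by rewrite /reward_addr addn1.
Qed.

Lemma history_lt_base : history_addr n m T + 1 + 2 * size h < base.
Proof. by rewrite /work_addr /type_addr; lia. Qed.

Lemma ev_size s : ev s w_size = size h.
Proof.
rewrite /w_size; cbn [weval]; rewrite ev_history ev_input ?inp_size //.
by have := history_lt_base; lia.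
Qed.

Lemma ev_query s : ev s w_query = j0.
Proof.
have E : ev s w_type = type_addr T h.
  by rewrite /w_type /w_double; cbn [weval]; rewrite ev_size ev_history.
rewrite /w_query; cbn [weval]; rewrite E ev_input ?inp_type //.
by rewrite /work_addr; lia.
Qed.

Lemma ev_event s k e k' : ev s k = k' -> k' < size h ->
  ev s (w_event k) = encode_decision (nth e h k').2.
Proof.
move=> kE kh; rewrite /w_event /w_double; cbn [weval].
rewrite ev_history kE ev_input ?(inp_event _ _ e) //.
by have := history_lt_base; lia.
Qed.

Lemma ev_cap s i i' : ev s i = i' -> i' < n -> ev s (w_cap i) = capd I i'.
Proof.
move=> iE iN; rewrite /w_cap; cbn [weval]; rewrite iE ev_input ?inp_cap //.
rewrite /work_addr /type_addr /history_addr /ptype_addr /demand_addr /reward_addr.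
lia.
Qed.

Lemma ev_reward s i j i' j' : ev s i = i' -> ev s j = j' -> i' < n -> j' < m ->
  ev s (w_num w_rewards (w_cell i j)) = rn i' j' /\
  ev s (w_den w_rewards (w_cell i j)) = rd i' j'.
Proof.
move=> iE jE iN jM; have [E1 E2] := inp_reward I h j0 iN jM.
have lt : i' * m + j' < n * m by nia.
rewrite /w_num /w_den /w_double /w_cell /w_rewards /w_succ; cbn [weval].
by rewrite iE jE ev_m ev_n !ev_input ?E1 ?E2 //
  /work_addr /type_addr /history_addr /ptype_addr /demand_addr /reward_addr; lia.
Qed.

Lemma ev_ptype s i j i' j' : ev s i = i' -> ev s j = j' -> i' < T -> j' < m ->
  ev s (w_num w_ptypes (w_cell i j)) = pn i' j' /\
  ev s (w_den w_ptypes (w_cell i j)) = pd i' j'.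
Proof.
move=> iE jE iN jM; have [E1 E2] := inp_ptype I h j0 iN jM.
have lt : i' * m + j' < T * m by nia.
have E3 : ev s w_ptypes = ptype_addr n m T.
  rewrite /w_ptypes /w_demands /w_rewards /w_double /w_succ; cbn [weval].
  by rewrite ev_n ev_m ev_T /ptype_addr /demand_addr /reward_addr addn1.
rewrite /w_num /w_den /w_double /w_cell /w_succ; cbn [weval].
by rewrite iE jE ev_m E3 !ev_input ?E1 ?E2 //
  /work_addr /type_addr /history_addr; lia.
Qed.

Lemma ev_demand s d d' : ev s d = d' -> d' <= T ->
  ev s (w_num w_demands d) = dn d' /\ ev s (w_den w_demands d) = dd d'.
Proof.
move=> dE dT; have [E1 E2] := inp_demand I h j0 dT.
have E3 : ev s w_demands = demand_addr n m.
  rewrite /w_demands /w_rewards /w_double /w_succ; cbn [weval].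
  by rewrite ev_n ev_m /demand_addr /reward_addr.
rewrite /w_num /w_den /w_double /w_succ; cbn [weval].
by rewrite dE E3 !ev_input ?E1 ?E2 //
  /work_addr /type_addr /history_addr /ptype_addr; lia.
Qed.

Lemma reward_le i j : i < n -> j < m -> rn i j <= 2 ^ B /\ rd i j <= 2 ^ B.
Proof.
rewrite /rn /rd => iN jM; have [<- <-] := inp_reward I h j0 iN jM.
by split; apply: ltnW; exact: inp_lt.
Qed.

Lemma ptype_le t j : t < T -> j < m -> pn t j <= 2 ^ B /\ pd t j <= 2 ^ B.
Proof.
rewrite /pn /pd => tT jM; have [<- <-] := inp_ptype I h j0 tT jM.
by split; apply: ltnW; exact: inp_lt.
Qed.

Lemma demand_le d : d <= T -> dn d <= 2 ^ B /\ dd d <= 2 ^ B.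
Proof.
rewrite /dn /dd => dT; have [<- <-] := inp_demand I h j0 dT.
by split; apply: ltnW; exact: inp_lt.
Qed.

Lemma cap_le i : i < n -> capd I i <= 2 ^ B.
Proof. by move=> iN; rewrite -(inp_cap I h j0 iN); apply: ltnW; exact: inp_lt. Qed.

Lemma dims_le : [/\ n <= B, T <= B, T * m <= B & m <= B].
Proof.
have := size_bit_size I.
rewrite /history_addr /ptype_addr /demand_addr /reward_addr.
have : m <= T * m by apply: leq_pmull; lia.
by move=> *; split; lia.
Qed.

Lemma bit_size_lt : B < 2 ^ total_bits.
Proof.
apply: ltn_trans (ltn_expl B (isT : 1 < 2)) _.
by rewrite ltn_exp2l // /total_bits /step_bits; nia.
Qed.

(* Registers not modified by [p_scan] and [p_raise]. *)
Definition frame (s s' : state) : Prop :=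
  forall r, r \in [:: r_surv_num; r_surv_den; r_q; r_j; r_ans; r_count; r_t] ->
    s'.1 r = s.1 r.

Definition rep_prices (e : nat) (mu : nat -> F) (s : state) : Prop :=
  forall i, i < n -> [/\ rep (s.2 (2 * i)) (s.2 (2 * i + 1)) (mu i),
    s.2 (2 * i) <= 2 ^ e & s.2 (2 * i + 1) <= 2 ^ e].

Definition rep_surv (e : nat) (S : F) (s : state) : Prop :=
  [/\ rep (s.1 r_surv_num) (s.1 r_surv_den) S,
      s.1 r_surv_num <= 2 ^ e & s.1 r_surv_den <= 2 ^ e].

(** Apart from the value of the best margin, the invariant keeps the factorization of its
    denominator and a bound on its numerator, from which [wp_raise] gets the length of the new
    price. *)
Definition scan_inv (S : F) j mu (s : state) i (s' : state) : Prop :=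
  let sc := scan S j mu i in
  [/\ s'.2 = s.2, frame s s', rep (s'.1 r_gap_num) (s'.1 r_gap_den) sc.1,
      s'.1 r_best = sc.2 &
      forall c, sc.2 = c.+1 ->
        [/\ s'.1 r_scale = s.1 r_surv_den * rd c j,
            s'.1 r_gap_den = s'.1 r_scale * s.2 (2 * c + 1) &
            s'.1 r_gap_num <= s.1 r_surv_num * rn c j * s.2 (2 * c + 1)]].

Lemma wp_compare e S j mu s i s' :
  surv_bits + B + e < total_bits -> s.1 r_j = j -> j < m -> i < n ->
  rep_surv surv_bits S s -> rep_prices e mu s ->
  scan_inv S j mu s i s' ->
  wp p_compare (scan_inv S j mu s i.+1) (set_reg s' r_i i).
Proof.
move=> eL sj jm iN [repS Sn_le Sd_le] repmu [arr fr repG best sc].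
have [repi Ni_le Di_le] := repmu _ iN.
have [rn_le rd_le] := reward_le iN jm.
have f0 : s'.1 r_surv_num = s.1 r_surv_num by apply: fr.
have f1 : s'.1 r_surv_den = s.1 r_surv_den by apply: fr.
have fj : s'.1 r_j = j by rewrite -sj; apply: fr.
have [gap_lt gap_rep] := rep_gap repS (rep_reward i j) repi repG.
have scale_le : s.1 r_surv_den * rd i j <= 2 ^ (surv_bits + B).
  exact: leq_pow2_mul.
have num_le : s.1 r_surv_num * rn i j * s.2 (2 * i + 1) <= 2 ^ (surv_bits + B + e).
  by rewrite leq_pow2_mul // leq_pow2_mul.
have den_le : s.1 r_surv_den * rd i j * s.2 (2 * i + 1) <= 2 ^ (surv_bits + B + e).
  by rewrite leq_pow2_mul.
have [nB _ _ _] := dims_le.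
have iL : i.+1 < 2 ^ total_bits.
  apply: leq_ltn_trans (leq_trans iN nB) _.
  by apply: ltn_trans (ltn_expl B (isT : 1 < 2)) _; rewrite ltn_exp2l //; lia.
rewrite /p_compare /w_price_den /w_price_num /w_succ /w_double; cbn [wpre].
set X := s.1 r_surv_den * rd i j in scale_le gap_lt gap_rep den_le *.
set D := s.2 (2 * i + 1) in Di_le num_le den_le gap_lt gap_rep *.
set g := (s.1 r_surv_num * rn i j * D - X * s.2 (2 * i)) in gap_lt gap_rep *.
have g_le : g <= 2 ^ (surv_bits + B + e) by apply: leq_trans num_le; exact: leq_subr.
set s1 := set_reg s' r_i i.
have rwE (s2 : state) : s2.1 r_i = i -> s2.1 r_j = j ->
    ev s2 (w_num w_rewards (w_cell (WR r_i) (WR r_j))) = rn i j /\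
    ev s2 (w_den w_rewards (w_cell (WR r_i) (WR r_j))) = rd i j.
  by move=> si sj2; apply: ev_reward.
have -> : ev s1 (WMul (WR r_surv_den) (w_den w_rewards (w_cell (WR r_i) (WR r_j))))
    = X by cbn [weval]; rewrite (rwE s1 erefl fj).2 /= f1.
split; first by apply: ltn_pow2_trans scale_le _; lia.
set s2 := set_reg s1 r_new_scale X.
set e2 := WSub _ _; have -> : ev s2 e2 = g.
  by rewrite /e2; cbn [weval]; rewrite (rwE s2 erefl fj).1 /= f0 arr.
split; first by apply: ltn_pow2_trans g_le _.
set s3 := set_reg s2 r_new_num g.
set e3 := WSub _ _; have -> : ev s3 e3 =
  (g * s'.1 r_gap_den - s'.1 r_gap_num * (X * D)).
  by rewrite /e3; cbn [weval]; rewrite /= arr.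
(* The machine test is now the comparison made by [scan_margins]. *)
rewrite subn_eq0 -ltnNge -gap_lt.
rewrite /scan_inv /scan_margins /= -/(scan S j mu i).
have fr3 : frame s s3.
  move=> r rs; rewrite -fr //.
  by move: rs; rewrite !inE => /or4P[|||/or4P[]] /eqP ->.
case: ifP => lt; rewrite lt; last by split.
split; first by apply: ltn_pow2_trans g_le _.
rewrite arr -/D addn1; split; first by apply: ltn_pow2_trans den_le _.
split; first by apply: ltn_pow2_trans scale_le _; lia.
split=> //.
split=> //=.
- by move=> r rs; rewrite -fr3 //; move: rs; rewrite !inE => /or4P[|||/or4P[]] /eqP ->.
- exact: gap_rep.
- by move=> c [<-]; split=> //; exact: leq_subr.
Qed.


Lemma wp_scan e S j mu s Q :
  surv_bits + B + e < total_bits -> s.1 r_j = j -> j < m ->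
  rep_surv surv_bits S s -> rep_prices e mu s ->
  (forall s', scan_inv S j mu s n s' -> Q s') -> wp p_scan Q s.
Proof.
move=> eL sj jm repS repmu HQ; have [nB _ _ _] := dims_le.
have p1 : 1 < 2 ^ total_bits by rewrite -{1}(expn0 2) ltn_exp2l //; lia.
rewrite /p_scan; cbn [wpre weval]; do 3!(split; first by lia).
exists n, (scan_inv S j mu s); split=> //.
- split=> //=; last by split=> //; rewrite mul0r.
  by move=> r; rewrite !inE => /or4P[|||/or4P[]] /eqP ->.
- by move=> i s' iN; apply: wp_compare eL sj jm iN repS repmu.
- move=> s' [arr fr repG best sc]; apply: HQ; split=> // r rs.
  by rewrite -fr //; move: rs; rewrite !inE => /or4P[|||/or4P[]] /eqP ->.
Qed.

Lemma wp_raise e S t j mu s s' Q :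
  step_bits + e < total_bits -> s.1 r_t = t -> t < T -> s.1 r_j = j -> j < m ->
  rep_surv surv_bits S s -> rep_prices e mu s -> scan_inv S j mu s n s' ->
  (forall s'', s''.1 = s'.1 ->
    rep_prices (step_bits + e)
      (raise_price n (capd IR) (rwd IR) (ptd IR t j) S j mu) s'' -> Q s'') ->
  wp p_raise Q s'.
Proof.
move=> eL st tT sj jm [repS Sn_le Sd_le] repmu [arr fr repG best sc] HQ.
rewrite /p_raise; cbn [wpre weval]; rewrite best.
case: ifP => [nz|/negbFE/eqP z]; last first.
  apply: HQ => // i iN; have [repi Ni_le Di_le] := repmu _ iN.
  rewrite arr /raise_price z; split=> //.
    by apply: leq_pow2_trans Ni_le _; rewrite leq_addl.
  by apply: leq_pow2_trans Di_le _; rewrite leq_addl.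
case E: (scan S j mu n).2 nz => [|c] // _.
have [scaleE denE num_le] := sc _ E.
have [cn gapE gap0] := scan_some E.
have [repc Nc_le Dc_le] := repmu _ cn.
have [rn_le rd_le] := reward_le cn jm.
have [pn_le pd_le] := ptype_le tT jm.
have k_le := cap_le cn.
have k0 : 0 < capd I c by rewrite /capd ext_nat; case: vI => c0 _ _ _ _; exact: c0.
have ft : s'.1 r_t = t by rewrite -st; apply: fr.
have fj : s'.1 r_j = j by rewrite -sj; apply: fr.
have ptE (s2 : state) : s2.1 r_t = t -> s2.1 r_j = j ->
    ev s2 (w_num w_ptypes (w_cell (WR r_t) (WR r_j))) = pn t j /\
    ev s2 (w_den w_ptypes (w_cell (WR r_t) (WR r_j))) = pd t j.
  by move=> s2t s2j; apply: ev_ptype.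
have capE (s2 : state) : s2.1 r_best = c.+1 ->
    ev s2 (w_cap (w_pred (WR r_best))) = capd I c.
  by move=> s2b; apply: ev_cap => //; rewrite /w_pred /= s2b subn1.
have bE : s'.1 r_best = c.+1 by rewrite best.
rewrite /w_price_num /w_double /w_succ /w_pred; cbn [weval].
rewrite (ptE s' ft fj).1 (ptE s' ft fj).2 (capE s' bE).
rewrite (ptE (set_arr s' _ _) ft fj).2 (capE (set_arr s' _ _) bE) bE subn1 arr.
set N' := (_ + _)%N; set D' := (_ * _)%N.
rewrite /= in N' D' *; rewrite bE subn1 /=.
have scale_le : s'.1 r_scale <= 2 ^ (surv_bits + B).
  by rewrite scaleE leq_pow2_mul.
have mult_le : pd t j * capd I c * s'.1 r_scale <= 2 ^ (3 * B + surv_bits).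
  rewrite (_ : 3 * B + surv_bits = B + B + (surv_bits + B)); last by lia.
  by rewrite !leq_pow2_mul.
have gap_le : s'.1 r_gap_num <= 2 ^ (surv_bits + B + e).
  by apply: leq_trans num_le _; rewrite !leq_pow2_mul.
have N'_le : N' <= 2 ^ (step_bits + e).
  rewrite (_ : step_bits + e = (3 * B + surv_bits + e).+1); last first.
    by rewrite /step_bits; lia.
  apply: leq_pow2_add.
    by rewrite addnC leq_pow2_mul.
  by apply: leq_pow2_trans (leq_pow2_mul pn_le gap_le) _; lia.
(* The old price denominator occurs only once in the new one. *)
have D'E : D' = pd t j * capd I c * s'.1 r_scale * s.2 (2 * c + 1).
  by rewrite /D' denE; ring.
have D'_le : D' <= 2 ^ (step_bits + e).
  rewrite D'E; apply: leq_pow2_trans (leq_pow2_mul mult_le Dc_le) _.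
  by rewrite /step_bits; lia.
split; first exact: ltn_pow2_trans N'_le _.
split; first exact: ltn_pow2_trans D'_le _.
apply: HQ => // i iN; have [repi Ni_le Di_le] := repmu _ iN.
have ne1 : (2 * i == 2 * c + 1) = false by apply/eqP; lia.
have ne2 : (2 * i + 1 == 2 * c) = false by apply/eqP; lia.
rewrite /= ne1 ne2 /raise_price E eqSS arr eqn_add2r eqn_pmul2l //.
case: (eqVneq i c) => [ic|_]; last first.
  by split=> //; [apply: leq_pow2_trans Ni_le _ | apply: leq_pow2_trans Di_le _];
    rewrite leq_addl.
subst i; split=> //.
have [D0 muE] := repi; have [pd0 ptEq] := rep_ptype t j.
have [G0 gE] := repG.
have X0 : 0 < s'.1 r_scale by move: G0; rewrite denE muln_gt0 => /andP[].
split; first by rewrite D'E !muln_gt0 pd0 k0 X0 D0.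
have nz k : 0 < k -> (k%:R != 0 :> F)%R by rewrite pnatr_eq0 lt0n.
rewrite D'E /N' gE muE ptEq denE !natrD !natrM.
by field; rewrite !nz.
Qed.


Lemma wp_record t j Q s : s.1 r_t = t -> s.1 r_j = j ->
  s.1 r_best < 2 ^ total_bits ->
  Q (if (t == size h) && (j == j0) then set_reg s r_ans (s.1 r_best) else s) ->
  wp p_record Q s.
Proof.
move=> st sj sb; rewrite /p_record /w_dist; cbn [wpre weval].
rewrite ev_size ev_query st sj => HQ.
have -> : (1 - (t - size h + (size h - t) + (j - j0 + (j0 - j))) != 0) =
    ((t == size h) && (j == j0)).
  by apply/idP/andP => [?|[/eqP -> /eqP ->]]; [split; apply/eqP; lia | lia].
by case: ifP HQ.
Qed.

Local Notation sweep := (sweep n (capd IR) (rwd IR) (ptd IR)).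
Local Notation choice := (best_choice n m T (capd IR) (rwd IR) (dmd IR) (ptd IR)).

Lemma surv_bits_le q : q <= T -> (B + 1) * q <= surv_bits.
Proof.
move=> qT; have [_ TB _ _] := dims_le.
by rewrite leq_mul2l (leq_trans qT) ?orbT.
Qed.

Lemma cells_le q j : q < T -> j <= m -> q * m + j <= B.
Proof. by move=> qT jm; have [_ _ TmB _] := dims_le; nia. Qed.

(** Steps are swept backwards and types forwards; the last clause says that the answer is right once
    the step [size h] and the type [j0] have been passed. *)
Definition sweep_inv (q : nat) (s : state) (j : nat) (s' : state) : Prop :=
  [/\ s'.1 r_surv_num = s.1 r_surv_num, s'.1 r_surv_den = s.1 r_surv_den,
      s'.1 r_count = 0 /\ s'.1 r_t = T - q.+1,
      rep_prices (step_bits * (q * m + j))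
        (sweep (T - q.+1) (prices q.+1).1 (prices q).2 j) s' &
      (T - q.+1 < size h) || (T - q.+1 == size h) && (j0 < j) ->
        s'.1 r_ans = choice (size h) j0].

Lemma wp_sweep_step q s j s' : q < T -> j < m ->
  rep_surv surv_bits (prices q.+1).1 s -> sweep_inv q s j s' ->
  wp (PSeq p_scan (PSeq p_raise p_record)) (sweep_inv q s j.+1) (set_reg s' r_j j).
Proof.
move=> qT jm repS [e0 e1 [ec et] repmu ans].
set S := (prices q.+1).1 in repS repmu *.
set mu := sweep _ S _ j in repmu.
set s1 := set_reg s' r_j j.
set e := step_bits * (q * m + j) in repmu.
have jB : q * m + j <= B by apply: cells_le => //; exact: ltnW.
have [nB TB TmB mB] := dims_le.
have bits : step_bits + e < total_bits.
  by rewrite /e /total_bits -mulnS addn1 ltnS leq_mul2l; apply/orP; right; lia.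
have repS1 : rep_surv surv_bits S s1 by case: repS => ? ? ?; split=> //=; rewrite ?e0 ?e1.
have repmu1 : rep_prices e mu s1 by [].
cbn [wpre]; apply: (@wp_scan e S j mu) => //.
  by move: bits; rewrite /step_bits; lia.
move=> s2 inv2; apply: (@wp_raise e S (T - q.+1) j mu s1) => //; first by lia.
move=> s3 regs3 repmu3; have [_ fr _ best _] := inv2.
have f r : r \in [:: r_surv_num; r_surv_den; r_q; r_j; r_ans; r_count; r_t] ->
    s3.1 r = s1.1 r by move=> rs; rewrite regs3; exact: fr.
apply: (@wp_record (T - q.+1) j).
- by rewrite f.
- by rewrite f.
- rewrite regs3 best; case E: (scan S j mu n).2 => [|c]; first by rewrite expn_gt0.
  have [cn _ _] := scan_some E.
  apply: leq_ltn_trans (leq_trans cn nB) _.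
  exact: bit_size_lt.
have repmu' : rep_prices (step_bits * (q * m + j.+1))
    (sweep (T - q.+1) S (prices q).2 j.+1) s3.
  by rewrite addnS mulnS.
(* At the current query the prices in the array are those of [price_before], so the scan has
   computed [best_choice]. *)
case: ifP => [/andP[/eqP tE /eqP jE]|ne].
  split; [by rewrite /= f|by rewrite /= f|by rewrite /= !f|exact: repmu'|move=> _].
  rewrite /= regs3 best /best_choice /price_before -jE -tE.
  have -> : T - (T - q.+1) = q.+1 by lia.
  by have -> : T - (T - q.+1).+1 = q by lia.
split; [by rewrite f|by rewrite f|by rewrite !f|exact: repmu'|move=> H].
rewrite f //; apply: ans.
move: H ne; rewrite ltnS (leq_eqVlt j0) (eq_sym (val j0)).
by case: (_ < size h) => //=; case: (_ == size h) => //= /orP[->|].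
Qed.

Definition prices_inv (q : nat) (s : state) : Prop :=
  [/\ s.1 r_count = 0, rep_surv ((B + 1) * q) (prices q).1 s,
      rep_prices (step_bits * (q * m)) (prices q).2 s &
      T - q <= size h -> s.1 r_ans = choice (size h) j0].

Lemma wp_prices_step q s : q < T -> prices_inv q s ->
  wp (PSeq p_survival (PFor r_j w_m (PSeq p_scan (PSeq p_raise p_record))))
     (prices_inv q.+1) (set_reg s r_q q).
Proof.
move=> qT [cnt [repS Sn_le Sd_le] repmu ans].
have [nB TB TmB mB] := dims_le.
have [S0 SE] := repS; have [d0 dE] := rep_demand (T - q).
have [dn_le dd_le] := demand_le (leq_subr q T).
set s1 := set_reg s r_q q.
have dmE (s2 : state) : s2.1 r_q = q ->
    ev s2 (w_num w_demands (WSub w_T (WR r_q))) = dn (T - q) /\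
    ev s2 (w_den w_demands (WSub w_T (WR r_q))) = dd (T - q).
  by move=> s2q; apply: ev_demand; [cbn [weval]; rewrite s2q ev_T | exact: leq_subr].
have bits : surv_bits < total_bits by rewrite /total_bits /step_bits; nia.
have bits' := leq_ltn_trans (surv_bits_le qT) bits.
have Sn'_le : s.1 r_surv_num * dd (T - q) + dn (T - q) * s.1 r_surv_den <=
    2 ^ ((B + 1) * q.+1).
  rewrite (_ : (B + 1) * q.+1 = ((B + 1) * q + B).+1); last by lia.
  by apply: leq_pow2_add; [|rewrite mulnC]; apply: leq_pow2_mul.
have Sd'_le : s.1 r_surv_den * dd (T - q) <= 2 ^ ((B + 1) * q.+1).
  apply: leq_pow2_trans (leq_pow2_mul Sd_le dd_le) _; lia.
rewrite /p_survival /w_succ; cbn [wpre].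
have -> : ev s1 (WSub w_T (WAdd (WR r_q) (WC 1))) = T - q.+1.
  by cbn [weval]; rewrite ev_T /= addn1.
split.
  apply: leq_ltn_trans (leq_subr _ _) _; apply: leq_ltn_trans TB _.
  exact: bit_size_lt.
set s2 := set_reg s1 r_t _.
set e2 := WAdd _ _.
have -> : ev s2 e2 = s.1 r_surv_num * dd (T - q) + dn (T - q) * s.1 r_surv_den.
  by rewrite /e2; cbn [weval]; rewrite (dmE s2 erefl).1 (dmE s2 erefl).2.
split; first exact: ltn_pow2_trans Sn'_le _.
set s3 := set_reg s2 r_surv_num _.
set e3 := WMul _ _.
have -> : ev s3 e3 = s.1 r_surv_den * dd (T - q).
  by rewrite /e3; cbn [weval]; rewrite (dmE s3 erefl).2.
split; first exact: ltn_pow2_trans Sd'_le _.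
set s4 := set_reg s3 r_surv_den _.
have repS' : rep_surv ((B + 1) * q.+1) (prices q.+1).1 s4.
  split=> //; split=> /=; first by rewrite muln_gt0 S0.
  have nz k : 0 < k -> (k%:R != 0 :> F)%R by rewrite pnatr_eq0 lt0n.
  by rewrite SE dE natrD !natrM; field; rewrite !nz.
have repS'' : rep_surv surv_bits (prices q.+1).1 s4.
  case: repS' => ? H1 H2.
  by split=> //; [apply: leq_pow2_trans H1 _ | apply: leq_pow2_trans H2 _];
    exact: surv_bits_le.
exists m, (sweep_inv q s4); split=> //.
- split=> //; first by rewrite addn0.
  rewrite ltn0 andbF orbF => lt; apply: ans; lia.
- by move=> j s' jm inv; apply: wp_sweep_step.
- move=> s' [e0 e1 [ec et] repmu' ans']; split=> //.
  + by case: repS' => H1 H2 H3; split; rewrite /= ?e0 ?e1.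
  + by rewrite mulSnr.
  + by move=> le; apply: ans'; rewrite ltn_ord andbT; lia.
Qed.

Lemma wp_prices Q :
  (forall s, s.1 r_count = 0 -> s.1 r_ans = choice (size h) j0 -> Q s) ->
  wp p_prices Q (fun=> 0, fun=> 0).
Proof.
move=> HQ; have [nB TB TmB mB] := dims_le.
have p1 : 1 < 2 ^ total_bits.
  by rewrite -{1}(expn0 2) ltn_exp2l // /total_bits; lia.
rewrite /p_prices /p_init /w_succ /w_double; cbn [wpre].
have rep0 : rep 0 1 (0%R : F) by split=> //; rewrite mul0r.
(* After i iterations the array holds 1 in the odd cells below 2 * i and 0 elsewhere. *)
exists n, (fun i (s : state) => (forall r, r != r_i -> s.1 r = 0) /\
  forall k, s.2 k = nat_of_bool (odd k && (k < 2 * i))); split=> //.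
- by split=> // k; rewrite andbF.
- move=> i s iN [s1 s2]; cbn [weval]; split=> //; split=> [r ri|k] /=.
    by rewrite (negbTE ri) s1.
  rewrite s2; case: eqP => [->|k1].
    by rewrite oddD oddM /= (_ : _ < _)%N //; lia.
  congr nat_of_bool; apply/andb_id2l => ok.
  apply/idP/idP => [?|kl]; first by lia.
  case: (ltngtP k (2 * i)) kl => // [kg kl|ke _]; last by rewrite ke oddM in ok.
  by case: k1; lia.
- move=> s [s1 s2]; cbn [weval]; split=> //; set s3 := set_reg _ _ _.
  exists T, prices_inv; split=> //.
  + split; first by rewrite /= s1.
    * by split; rewrite /= ?s1 // expn_gt0.
    * move=> i iN; rewrite /= !s2 oddD oddM /=.
      have -> : 2 * i + 1 < 2 * n by lia.
      by split=> //; rewrite expn_gt0.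
    * by rewrite subn0; lia.
  + exact: wp_prices_step.
  + by move=> s4 [cnt _ _ ans]; apply: HQ => //=; apply: ans; rewrite subnn.
Qed.

Lemma choice_le : choice (size h) j0 <= n.
Proof.
rewrite /best_choice; case E: (scan_margins _ _ _ _ _).2 => [|c] //.
by have [] := scan_some E.
Qed.

Lemma wp_check Q s : s.1 r_count = 0 -> s.1 r_ans = choice (size h) j0 ->
  (forall s', s'.1 r_ans = encode_decision (decision IR h j0) -> Q s') ->
  wp p_check Q s.
Proof.
move=> cnt ans HQ; have [nB TB TmB mB] := dims_le.
have BL : B < 2 ^ total_bits.
  exact: bit_size_lt.
set c := choice (size h) j0 in ans.
pose hits k := count (fun e : event n m => encode_decision e.2 == c) (take k h).
rewrite /p_check /w_dist /w_succ; cbn [wpre].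
exists (size h), (fun k s' => s'.1 r_count = hits k /\ s'.1 r_ans = c); split=> //.
- by move=> s'; rewrite ev_size.
- by apply: ltnW; apply: leq_trans hT TB.
- by rewrite /hits take0.
- move=> k s' kh [cntk ansk]; cbn [weval].
  have e0 : event n m by case: (h) kh => // e *; exact: e.
  rewrite (ev_event (s := set_reg s' r_i k) (k := WR r_i) e0 erefl kh) /= ansk cntk.
  have hitsS : hits k.+1 = hits k + (encode_decision (nth e0 h k).2 == c).
    by rewrite /hits (take_nth e0) // -cats1 count_cat /= addn0.
  set d := encode_decision _ in hitsS *.
  have hits_le : hits k.+1 <= B.
    apply: leq_trans (count_size _ _) _; rewrite size_take_min.
    by apply: leq_trans (geq_minr _ _) _; apply: ltnW; apply: leq_trans hT TB.
  have -> : (1 - (d - c + (c - d)) != 0) = (d == c).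
    by apply/idP/eqP => [?|->]; lia.
  case: eqP hitsS => [_|_] hitsS; last by split=> //=; rewrite hitsS addn0.
  rewrite -hitsS; split; first exact: leq_ltn_trans hits_le BL.
  by split.
- move=> s' [cntk ansk]; cbn [weval]; rewrite [(set_reg _ _ _).1 _]/= ansk.
  rewrite /hits take_size in cntk.
  case: ifP => [c0|/negbFE/eqP E]; last first.
    by apply: HQ; rewrite /= ansk E /decision -/c E.
  case E: c c0 => [|a] // _.
  have an : a < n by have := choice_le; rewrite -/c E.
  have usedE : count (fun e : event n m => encode_decision e.2 == c) h =
      used h (Ordinal an).
    apply: eq_count => -[j [i|]] /=; rewrite E //.
  have decE : decision IR h j0 =
      if used h (Ordinal an) < cap I (Ordinal an) then Some (Ordinal an) else None.
    by rewrite /decision -/c E (insubT (fun i => i < n) an).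
  rewrite (ev_cap (i' := a)) //; last by rewrite /w_pred /= ansk E subn1.
  rewrite [(set_reg _ _ _).1 r_count]/= cntk usedE subn_eq0 -ltnNge.
  rewrite /capd (ext_nat _ _ an).
  case: ifP => lt; first by apply: HQ; rewrite /= ansk E decE lt.
  by split; [rewrite expn_gt0 | apply: HQ; rewrite /= decE lt].
Qed.

Lemma wp_price_prog :
  wp price_prog (fun s => s.1 r_ans = encode_decision (decision IR h j0))
     (fun=> 0, fun=> 0).
Proof.
rewrite /price_prog; cbn [wpre]; apply: wp_prices => s cnt ans.
exact: wp_check.
Qed.

End Simulation.

(** * Polynomial running time of the price policy *)

Lemma poly_bound (K d : nat) :
  exists e, forall B, (0 < B)%N -> (K * B ^ d <= e * B ^ e)%N.
Proof.
(* One number must serve both as coefficient and as exponent. *)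
exists (K + d)%N => B B0; apply: leq_mul; first exact: leq_addr.
by rewrite leq_pexp2l // leq_addl.
Qed.

Lemma bit_size_gt0 n m T (I : instance rat n m T) : (0 < bit_size I)%N.
Proof.
apply: leq_trans (size_bit_size I).
by rewrite /history_addr /ptype_addr /demand_addr /reward_addr; lia.
Qed.

(** With B the bit size, [total_bits] expands to B^3 + 5 B^2 + 5 B + 2, whose coefficients add up to
    13. *)
Lemma total_bits_le n m T (I : instance rat n m T) :
  (total_bits I <= 13 * bit_size I ^ 3)%N.
Proof.
have := bit_size_gt0 I; rewrite /total_bits /step_bits /surv_bits.
by move: (bit_size I) => B B0; rewrite !expnS expn0; nia.
Qed.

Lemma price_cmd_exec (F : realFieldType) n m T (I : instance rat n m T)
    (h : seq (event n m)) (j : 'I_m) (w : nat -> bool) :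
  valid I -> (size h < T)%N ->
  exists k s, [/\ exec w price_cmd (initial_memory I h j) k s,
    (k <= (prog_cost work_expr (bit_size I) price_prog +
           store_coef (Const 0) (compile_expr work_expr (WR 8))) * total_bits I)%N &
    s 0%N = encode_decision (decision (map_instance (@ratr F) I) h j)].
Proof.
move=> vI hT; set inp := initial_memory I h j; set base := work_addr T h.
have mem0 : inp = mem_of inp base (fun=> 0%N, fun=> 0%N).
  apply/funext => a; rewrite /mem_of; case: ltnP => // ha.
  by rewrite if_same /inp inp_beyond.
have bits : (bit_size I < total_bits I)%N.
  by rewrite /total_bits /step_bits /surv_bits; nia.
have workE s : eval w (mem_of inp base s) work_expr = base.
  change (weval inp base s w_work = base).
  rewrite /w_work /w_type /w_succ /w_double; cbn [weval].
  by rewrite ev_size // ev_history.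
have inpL a : (inp a < 2 ^ total_bits I)%N.
  apply: leq_trans (inp_lt I j a hT) _; rewrite leq_exp2l //; exact: ltnW.
have L0 : (0 < total_bits I)%N by apply: leq_ltn_trans bits.
have ML : (bit_size I < 2 ^ total_bits I)%N.
  by apply: ltn_trans (ltn_expl _ (isT : 1 < 2)%N) _; rewrite ltn_exp2l.
have /andP[wf1 wf2] := price_prog_wf.
have b0 : bounded (total_bits I) (fun=> 0%N, fun=> 0%N).
  by split=> r /=; rewrite expn_gt0.
have [k1 [s1 [e1 l1 b1 ans]]] :=
  wp_sound workE inpL L0 ML wf1 wf2 b0 (wp_price_prog F j vI hT).
rewrite -mem0 in e1.
have cost := store_cost_le base w inpL L0 (Const 0) (compile_expr work_expr (WR 8)) b1.
eexists; eexists; split; first by apply: ExecSeq e1 _; exact: ExecStore.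
  by rewrite mulnDl leq_add.
change (eval w (mem_of inp base s1) (compile_expr work_expr (WR 8)) =
  encode_decision (decision (map_instance (@ratr F) I) h j)).
by rewrite (eval_compile workE).
Qed.

Lemma polynomial_time_price_policy (R : realType) :
  polynomial_time (fun n m T => @price_policy R n m T).
Proof.
set K1 := prog_cost work_expr 1 price_prog.
set K2 := store_coef (Const 0) (compile_expr work_expr (WR 8)).
have [e eP] := poly_bound ((K1 + K2) * 13) (depth price_prog + 3).
exists price_cmd, e => n m T I vI h j hT.
set IR := map_instance _ I.
exists (fun=> decision IR h j); split=> [w|a].
  have [k [s [ex kL s0]]] := price_cmd_exec R j (nth false w) vI hT.
  exists k, s; split=> //; apply: leq_trans kL _.
  apply: leq_trans (eP _ (bit_size_gt0 I)).
  have B0 := bit_size_gt0 I.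
  rewrite expnD mulnACA -/K2.
  apply: leq_mul; last exact: total_bits_le.
  rewrite mulnDl; apply: leq_add; first exact: prog_cost_poly.
  by rewrite leq_pmulr // expn_gt0 B0.
(* The decision ignores the coins, so either all coin strings or none lead to a. *)
rewrite /price_policy; have [_|_] := eqVneq a (decision IR h j).
  have -> : #|[pred _ : (e * bit_size I ^ e).-tuple bool | true]| =
    (2 ^ (e * bit_size I ^ e))%N.
    by rewrite cardT -cardE card_tuple card_bool.
  by rewrite natrX divff // expf_neq0.
by rewrite eq_card0 ?mul0r.
Qed.

(** * Comparison of the policy with the linear program and the optimum *)

Section Ratio.
Variables (R : realType) (n m T : nat) (I : instance R n m T).
Hypothesis vI : valid I.

Lemma lp_objective_le y : lp_feasible I y ->
  lp_objective I y <= 2 * ALG I (price_policy I).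
Proof.
move=> fy; apply: le_trans (lp_weak_duality vI fy) _.
by rewrite ler_pM2l ?ltr0n // price_policy_bound.
Qed.

Lemma LPcond_le : LPcond I <= 2 * ALG I (price_policy I).
Proof.
apply: ge_sup => [|_ [y fy <-]]; last exact: lp_objective_le.
(* Bounding a supremum requires a feasible point; the occupation of the policy is one. *)
exists (lp_objective I (occupation I (price_policy I))).
exists (occupation I (price_policy I)) => //.
by apply: occupation_feasible => //; exact: online_price_policy.
Qed.

Lemma ALG_le_LPcond pi : online I pi -> ALG I pi <= LPcond I.
Proof.
move=> onl; rewrite (occupation_objective vI onl); apply: ub_le_sup.
  (* Weak duality provides the upper bound that makes [LPcond] a genuine supremum. *)
  by exists (2 * ALG I (price_policy I)) => _ [y fy <-]; exact: lp_objective_le.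
by exists (occupation I pi) => //; exact: occupation_feasible.
Qed.

Lemma OPT_le_LPcond : OPT I <= LPcond I.
Proof.
apply: ge_sup => [|_ [pi onl <-]]; last exact: ALG_le_LPcond.
exists (ALG I (price_policy I)), (price_policy I) => //.
exact: online_price_policy.
Qed.

End Ratio.

Theorem theorem2 (R : realType) :
  exists A : forall n m T : nat, instance R n m T -> policy R n m,
    [/\ polynomial_time A,
        forall (n m T : nat) (I : instance R n m T), valid I ->
          [/\ online I (A n m T I),
              2^-1 * LPcond I <= ALG I (A n m T I) &
              2^-1 * OPT I <= 2^-1 * LPcond I],
        (ereal_inf (ratios_LPcond A) <= ereal_inf (ratios_OPT A))%E &
        ((2^-1 : R)%:E <= ereal_inf (ratios_LPcond A))%E].
Proof.
exists (fun n m T => @price_policy R n m T); split.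
- exact: polynomial_time_price_policy.
- move=> n m T I vI; split; first exact: online_price_policy.
    by rewrite ler_pdivrMl ?ltr0n // LPcond_le.
  by rewrite ler_pM2l ?invr_gt0 ?ltr0n // OPT_le_LPcond.
- apply: le_ereal_inf_tmp => _ [n [m [T [I [vI cI opt0 ->]]]]].
  (* An instance with positive optimum also has a positive linear program value, so it contributes
     to both sets of ratios, and dividing by the larger value gives the smaller ratio. *)
  have lp0 := lt_le_trans opt0 (OPT_le_LPcond vI).
  apply: (@le_trans _ _ (ALG I (price_policy I) / LPcond I)%:E).
    by apply: ereal_inf_lbound; exists n, m, T, I.
  rewrite lee_fin ler_wpM2l ?lef_pV2 ?posrE ?OPT_le_LPcond //.
  by apply: ALG_ge0 => //; exact: online_price_policy.
- apply: le_ereal_inf_tmp => _ [n [m [T [I [vI cI lp0 ->]]]]].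
  by rewrite lee_fin ler_pdivlMr // ler_pdivrMl ?ltr0n // LPcond_le.
Qed.
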